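(* Let $E/\mathbb{Q}$ be an elliptic curve over $\mathbb{Q}$ whose analytic rank is at most $1$. Let $G$ be a topologically finitely generated closed subgroup of $G_\mathbb{Q} := \mathrm{Gal}(\overline{\mathbb{Q}}/\mathbb{Q})$, and let $\overline{\mathbb{Q}}^G$ be the subfield of $\overline{\mathbb{Q}}$ fixed by $G$. Then the rank of $E$ over $\overline{\mathbb{Q}}^G$ is infinite, i.e. $\dim_\mathbb{Q} E(\overline{\mathbb{Q}}^G)\otimes\mathbb{Q} = \infty$.
   Context: The analytic rank of $E/\mathbb{Q}$ is the order of vanishing at $s=1$ of the Hasse–Weil $L$-function $L(E,s)$. A profinite group is topologically finitely generated if it has a finitely generated dense subgroup. *)

(* Defs.v *)
From Stdlib Require Import Reals.
From Coquelicot Require Import Coquelicot.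
From HB Require Import structures.
From mathcomp Require Import all_boot all_order all_algebra all_field.
Set Implicit Arguments. Unset Strict Implicit. Unset Printing Implicit Defensive.
Import GRing.Theory Num.Theory.

(* Weierstrass equations  y^2 + a1 xy + a3 y = x^3 + a2 x^2 + a4 x + a6 *)
Record weq (T : Type) := Weq { a1 : T; a2 : T; a3 : T; a4 : T; a6 : T }.

Section Disc.
Local Open Scope ring_scope.
Variable F : comNzRingType.
Definition wdisc (e : weq F) : F :=
  let b2 := a1 e ^+ 2 + 4%:R * a2 e in
  let b4 := 2%:R * a4 e + a1 e * a3 e in
  let b6 := a3 e ^+ 2 + 4%:R * a6 e in
  let b8 := a1 e ^+ 2 * a6 e + 4%:R * a2 e * a6 e - a1 e * a3 e * a4 e
            + a2 e * a3 e ^+ 2 - a4 e ^+ 2 in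
  - b2 ^+ 2 * b8 - 8%:R * b4 ^+ 3 - 27%:R * b6 ^+ 2 + 9%:R * b2 * b4 * b6.
End Disc.

Definition is_elliptic (E : weq rat) : Prop := (wdisc E != 0)%R.

(* Isomorphism of Weierstrass equations over Q (Silverman, Table 3.1):
   the change of variables x = u^2 x' + r, y = u^3 y' + u^2 s x' + t. *)
Definition wiso (E E' : weq rat) : Prop :=
  exists u r s t : rat, (u != 0)%R /\
    (u * a1 E' = a1 E + 2%:R * s)%R /\
    (u ^+ 2 * a2 E' = a2 E - s * a1 E + 3%:R * r - s ^+ 2)%R /\
    (u ^+ 3 * a3 E' = a3 E + r * a1 E + 2%:R * t)%R /\
    (u ^+ 4 * a4 E' = a4 E - s * a3 E + 2%:R * r * a2 E - (t + r * s) * a1 E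
                      + 3%:R * r ^+ 2 - 2%:R * s * t)%R /\
    (u ^+ 6 * a6 E' = a6 E + r * a4 E + r ^+ 2 * a2 E + r ^+ 3 - t * a3 E
                      - t ^+ 2 - r * t * a1 E)%R.

Definition weq_int_to_rat (M : weq int) : weq rat :=
  Weq ((a1 M)%:~R)%R ((a2 M)%:~R)%R ((a3 M)%:~R)%R ((a4 M)%:~R)%R ((a6 M)%:~R)%R.

Definition minimal_model (E : weq rat) (M : weq int) : Prop :=
  wiso E (weq_int_to_rat M) /\
  forall M' : weq int, wiso E (weq_int_to_rat M') ->
    (`|wdisc M| <= `|wdisc M'|)%R.

Definition nsols_mod (M : weq int) (p : nat) : nat :=
  count (fun xy : nat * nat =>
           let x : int := xy.1 in let y : int := xy.2 in
           ((y ^+ 2 + a1 M * x * y + a3 M * y)%R ==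
            (x ^+ 3 + a2 M * x ^+ 2 + a4 M * x + a6 M)%R %[mod p])%Z)
        [seq (x, y) | x <- iota 0 p, y <- iota 0 p].

(* a_p = p + 1 - #Ered(F_p) (projective count, the point at infinity included);
   this gives the usual a_p at good primes and 1, -1, 0 at split multiplicative,
   non-split multiplicative, additive primes. *)
Definition ap (M : weq int) (p : nat) : int := (p%:Z - (nsols_mod M p)%:Z)%R.

Definition goodp (M : weq int) (p : nat) : bool := ~~ (p%:Z %| wdisc M)%Z.

Definition IZR_int (z : int) : R :=
  match z with Posz n => INR n | Negz n => Ropp (INR (S n)) end.

Definition npow_neg (p : nat) (s : C) : C :=
  let lp := ln (INR p) in
  let r := exp (Ropp (Rmult (fst s) lp)) in
  (Rmult r (cos (Ropp (Rmult (snd s) lp))), Rmult r (sin (Ropp (Rmult (snd s) lp)))).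

Definition euler_factor (M : weq int) (p : nat) (s : C) : C :=
  Cinv (Cminus (Cplus (RtoC R1) (Cmult (RtoC (if goodp M p then INR p else R0))
                               (Cmult (npow_neg p s) (npow_neg p s))))
               (Cmult (RtoC (IZR_int (ap M p))) (npow_neg p s))).

Definition euler_partial (M : weq int) (s : C) (N : nat) : C :=
  foldr Cmult (RtoC R1) [seq euler_factor M p s | p <- iota 0 N.+1 & prime p].

Definition entire (f : C -> C) : Prop :=
  forall z : C, @ex_derive C_AbsRing C_NormedModule f z.

(* analytic rank <= 1: L(E,s), defined by its Euler product on Re s > 3/2,
   continues to an entire function whose order of vanishing at s = 1 is <= 1,
   i.e. L(E,1) <> 0 or L'(E,1) <> 0. *)
Definition analytic_rank_le1 (E : weq rat) : Prop :=
  exists (M : weq int) (L : C -> C),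
    minimal_model E M /\ entire L /\
    (forall s : C, Rlt (Rdiv (INR 3) (INR 2)) (fst s) ->
       filterlim (euler_partial M s) eventually (locally (L s))) /\
    (L (RtoC R1) <> RtoC R0 \/
     exists l : C, @is_derive C_AbsRing C_NormedModule L (RtoC R1) l /\ l <> RtoC R0).

Section Points.
Local Open Scope ring_scope.
Variable E : weq rat.
Let A1 : algC := ratr (a1 E). Let A2 : algC := ratr (a2 E).
Let A3 : algC := ratr (a3 E). Let A4 : algC := ratr (a4 E).
Let A6 : algC := ratr (a6 E).

(* None is the point at infinity O *)
Definition pt := option (algC * algC).

Definition on_curve (P : pt) : bool :=
  if P is Some (x, y) then
    y ^+ 2 + A1 * x * y + A3 * y == x ^+ 3 + A2 * x ^+ 2 + A4 * x + A6
  else true.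

Definition pt_neg (P : pt) : pt :=
  if P is Some (x, y) then Some (x, - y - A1 * x - A3) else None.

(* chord-and-tangent addition (Silverman, Alg. III.2.3) *)
Definition pt_add (P Q : pt) : pt :=
  match P, Q with
  | None, _ => Q
  | _, None => P
  | Some (x1, y1), Some (x2, y2) =>
    if (x1 == x2) && (y1 + y2 + A1 * x2 + A3 == 0) then None else
    let l := if x1 != x2 then (y2 - y1) / (x2 - x1)
             else (3%:R * x1 ^+ 2 + 2%:R * A2 * x1 + A4 - A1 * y1)
                  / (2%:R * y1 + A1 * x1 + A3) in
    let nu := y1 - l * x1 in
    let x3 := l ^+ 2 + A1 * l - A2 - x1 - x2 in
    Some (x3, - (l + A1) * x3 - nu - A3)
  end.

Fixpoint pt_natmul (P : pt) (n : nat) : pt :=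
  if n is n'.+1 then pt_add P (pt_natmul P n') else None.

Definition pt_intmul (P : pt) (z : int) : pt :=
  match z with Posz n => pt_natmul P n | Negz n => pt_neg (pt_natmul P n.+1) end.

Definition pt_lincomb (Ps : seq pt) (cs : seq int) : pt :=
  foldr pt_add None [seq pt_intmul PC.1 PC.2 | PC <- zip Ps cs].

Definition pt_in (K : algC -> Prop) (P : pt) : Prop :=
  on_curve P /\ (if P is Some (x, y) then K x /\ K y else True).

(* dim_Q E(K) (x)_Z Q = infinity : for every n there are n points of E(K)
   that are Z-linearly independent (equivalently, Q-linearly independent
   in E(K) (x) Q, since the kernel of E(K) -> E(K) (x) Q is the torsion). *)
Definition infinite_rank (K : algC -> Prop) : Prop :=
  forall n : nat, exists Ps : seq pt,
    size Ps = n /\ (forall P, P \in Ps -> pt_in K P) /\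
    forall cs : seq int, size cs = n -> pt_lincomb Ps cs = None ->
      forall c, c \in cs -> c = 0.
End Points.

Definition galQ (f : algC -> algC) : Prop :=
  (forall x y, f (x + y) = f x + f y)%R /\ (forall x y, f (x * y) = f x * f y)%R /\
  f 1%R = 1%R /\ bijective f.

(* basic Krull neighbourhoods: tau agrees with sigma on a finite set S *)
Definition agree_on (S : seq algC) (f g : algC -> algC) : Prop :=
  forall x, x \in S -> f x = g x.

Definition closed_subgroup (G : (algC -> algC) -> Prop) : Prop :=
  (forall f, G f -> galQ f) /\
  G id /\
  (forall f g, G f -> G g -> G (f \o g)) /\
  (forall f g, G f -> galQ g -> (forall x, g (f x) = x) -> G g) /\
  (forall f, galQ f -> (forall S, exists g, G g /\ agree_on S f g) -> G f).

Inductive gen_by (gs : seq (algC -> algC)) : (algC -> algC) -> Prop :=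
| gen_id : gen_by gs id
| gen_gen : forall f, List.In f gs -> gen_by gs f
| gen_comp : forall f g, gen_by gs f -> gen_by gs g -> gen_by gs (f \o g)
| gen_inv : forall f g, gen_by gs f -> (forall x, g (f x) = x) ->
                        (forall x, f (g x) = x) -> gen_by gs g.

Definition top_fin_gen (G : (algC -> algC) -> Prop) : Prop :=
  exists gs : seq (algC -> algC), (forall g, List.In g gs -> G g) /\
    forall f, G f -> forall S, exists h, gen_by gs h /\ agree_on S f h.

Definition fixed_field (G : (algC -> algC) -> Prop) (x : algC) : Prop :=
  forall f, G f -> f x = x.

(* Main.v *)
Require Import Defs.
From Stdlib Require Import Reals.
From Coquelicot Require Import Coquelicot.
From HB Require Import structures.
From mathcomp Require Import all_boot all_order all_algebra all_field.
From mathcomp Require Import ring zify.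
From mathcomp Require boolp classical_sets.
Set Implicit Arguments. Unset Strict Implicit. Unset Printing Implicit Defensive.
Import GRing.Theory Num.Theory.
Local Open Scope ring_scope.

(** The square classes of a field with topologically finitely generated absolute
    Galois group are finite in number, so Ramsey theory applies to them. Let F be the
    fixed field of G and y^2 = f(x) an integral short model of E, and enlarge F to a
    finite extension F' containing the roots th_k of f and eta = sqrt (f e) for some
    natural number e. Gallai's theorem, applied to the colouring of F' by square
    classes, produces u in F' such that all the u + l, with l in a prescribed finite
    set, lie in one square class. Writing
      f (e + g / (u + b)) = f e * \prod_k (u + b + g / (e - th_k)) / (u + b)
    turns this into points of E(F') with abscissa e + g / (u + b), for finitely many
    prescribed values of g, and their traces down to F are points of E(F).

    These traces are shown to be new as follows. Given finitely many points of E(F),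
    choose an automorphism tau fixing their coordinates and moving an element of F.
    For a difference Q of two of the points above, T - tau T, where T is the trace
    of Q, is the sum of the +- s(Q) for s in a family of distinct embeddings of F'.
    At a place above 2 all the s(Q) are close to the origin, and their formal
    parameters are, to first order, linear in s(g) with coefficients depending on s
    and u only. A Vandermonde argument over the chosen values of g shows that one of
    these sums is nonzero in the formal group, hence of infinite order, so T is
    independent of the given points. *)

(** * The group law in short Weierstrass form *)

(** Gallai's theorem gives no control over u, whose conjugates may have any 2-adic size; this
    dictates the form of the estimates. A shift b, chosen once u is known, keeps the conjugates of u
    + b from being too divisible by 2, but nothing bounds them from the other side, so the errors in
    the formal parameters are measured relative to the parameters themselves. The linear
    coefficients of the various embeddings may differ widely in size, and only the largest is
    compared with the error. The determinant behind the Vandermonde argument has to be bounded below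
    before u exists, for every admissible selection of the values of g at once, because these values
    are scaled by a power of 2 that depends on the bound. The signs of the ordinates near eta and -
    eta escape control as well: more values of g are prescribed than needed, and a pigeonhole on
    sign patterns selects enough of them. Since e is rational, all conjugate points lie near the
    same abscissa, and differences move them from there to the origin. *)

Record curve (F : fieldType) := Curve {
  cA : F; cB : F;
  curve_disc : - 16%:R * (4%:R * cA ^+ 3 + 27%:R * cB ^+ 2) != 0 }.

Section GroupLaw.
Variable F : fieldType.
Variable E : curve F.
Local Notation A := (cA E).
Local Notation B := (cB E).

Definition on_ec (P : option (F * F)) : bool :=
  if P is Some (x, y) then y ^+ 2 == x ^+ 3 + A * x + B else true.

Definition opp_ec (P : option (F * F)) : option (F * F) :=
  if P is Some (x, y) then Some (x, - y) else None.

(** Already reflected: this is the opposite of the third intersection point of the line of slope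
    [l]. *)
Definition third (l x1 y1 x2 : F) : option (F * F) :=
  let x3 := l ^+ 2 - x1 - x2 in Some (x3, - (l * (x3 - x1) + y1)).

Definition add_ec (P Q : option (F * F)) : option (F * F) :=
  match P, Q with
  | None, _ => Q
  | _, None => P
  | Some (x1, y1), Some (x2, y2) =>
    if (x1 == x2) && (y1 + y2 == 0) then None else
    third (if x1 == x2 then (3%:R * x1 ^+ 2 + A) / (2%:R * y1)
           else (y2 - y1) / (x2 - x1)) x1 y1 x2
  end.

(* The second equation is the difference of the two curve equations divided by
   x2 - x1, so that chords and tangents are treated alike. *)
Definition is_slope (l x1 y1 x2 y2 : F) : Prop :=
  y2 - y1 = l * (x2 - x1) /\
  l * (y1 + y2) = x1 ^+ 2 + x1 * x2 + x2 ^+ 2 + A.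

Lemma two_neq0 : 2%:R != 0 :> F.
Proof.
apply: contraNneq (curve_disc E) => h2.
have -> : 16%:R = 2%:R * 8%:R :> F by ring.
by rewrite h2 !(mul0r, oppr0).
Qed.

Lemma singular_contra x : x ^+ 3 + A * x + B = 0 -> 3%:R * x ^+ 2 + A = 0 -> False.
Proof.
move=> h1 h2; move: (curve_disc E).
have -> : A = - (3%:R * x ^+ 2) by apply/eqP; rewrite -addr_eq0 addrC h2.
have -> : B = 2%:R * x ^+ 3.
  have -> : B = (x ^+ 3 + A * x + B) - x * (3%:R * x ^+ 2 + A) + 2%:R * x ^+ 3 by ring.
  by rewrite h1 h2; ring.
by apply/negP/negPn/eqP; ring.
Qed.

Lemma is_slopeC l x1 y1 x2 y2 : is_slope l x1 y1 x2 y2 -> is_slope l x2 y2 x1 y1.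
Proof.
case=> h1 h2; split; last by rewrite addrC h2; ring.
by rewrite -opprB h1; ring.
Qed.

Lemma on_ec_eqx x y1 y2 : on_ec (Some (x, y1)) -> on_ec (Some (x, y2)) ->
  (y1 + y2 == 0) = false -> y1 = y2.
Proof.
move=> /eqP h1 /eqP h2 h; apply/eqP; rewrite -subr_eq0.
have /eqP : (y1 - y2) * (y1 + y2) = 0 by rewrite -subr_sqr h1 h2 subrr.
by rewrite mulf_eq0 h orbF.
Qed.

Lemma slope_exists x1 y1 x2 y2 :
  on_ec (Some (x1, y1)) -> on_ec (Some (x2, y2)) ->
  ~~ ((x1 == x2) && (y1 + y2 == 0)) -> exists l, is_slope l x1 y1 x2 y2.
Proof.
move=> o1 o2; case: eqVneq => [e|ne] /=; last first.
  move=> _; exists ((y2 - y1) / (x2 - x1)).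
  have d0 : x2 - x1 != 0 by rewrite subr_eq0 eq_sym.
  split; first by field.
  move/eqP: o1 => o1; move/eqP: o2 => o2.
  apply: (mulfI d0); transitivity (y2 ^+ 2 - y1 ^+ 2); first by field.
  by rewrite o1 o2; ring.
move=> h; subst x2; have e := on_ec_eqx o1 o2 (negbTE h); subst y2.
exists ((3%:R * x1 ^+ 2 + A) / (2%:R * y1)).
have y0 : y1 != 0 by apply: contraNneq h => ->; rewrite addr0.
split; first by rewrite !subrr mulr0.
by field; rewrite two_neq0 y0.
Qed.

Lemma add_slope l x1 y1 x2 y2 :
  ~~ ((x1 == x2) && (y1 + y2 == 0)) -> is_slope l x1 y1 x2 y2 ->
  add_ec (Some (x1, y1)) (Some (x2, y2)) = third l x1 y1 x2.
Proof.
move=> h [s1 s2]; rewrite /= (negbTE h); congr (third _ _ _ _).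
case: eqVneq h => [e|ne] /= h; last first.
  by rewrite s1 mulfK // subr_eq0 eq_sym.
subst x2; move: s1; rewrite subrr mulr0 => /eqP; rewrite subr_eq0 => /eqP e; subst y2.
have y0 : y1 != 0 by apply: contraNneq h => ->; rewrite addr0.
have -> : 3%:R * x1 ^+ 2 + A = l * (y1 + y1) by rewrite s2; ring.
by field; rewrite two_neq0 y0.
Qed.

Lemma slope_uniq l m x1 y1 x2 y2 :
  ~~ ((x1 == x2) && (y1 + y2 == 0)) -> is_slope l x1 y1 x2 y2 ->
  is_slope m x1 y1 x2 y2 -> l = m.
Proof.
move=> h [s1 s2] [t1 t2]; case: eqVneq h => [e|ne] /= h; last first.
  by apply: (@mulIf _ (x2 - x1)); rewrite ?subr_eq0 1?eq_sym // -s1.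
by apply: (mulIf h); rewrite s2.
Qed.

Lemma on_third l x1 y1 x2 y2 : on_ec (Some (x1, y1)) -> is_slope l x1 y1 x2 y2 ->
  on_ec (third l x1 y1 x2).
Proof.
move=> /eqP o1 [s1 s2]; rewrite /third /on_ec; apply/eqP.
have eB : B = y1 ^+ 2 - x1 ^+ 3 - A * x1 by rewrite o1; ring.
have e2 : y2 = y1 + l * (x2 - x1) by rewrite -s1; ring.
have eA : A = l * (y1 + y2) - x1 ^+ 2 - x1 * x2 - x2 ^+ 2 by rewrite s2; ring.
by rewrite eB eA e2; ring.
Qed.

Lemma on_add P Q : on_ec P -> on_ec Q -> on_ec (add_ec P Q).
Proof.
case: P => [[x1 y1]|] //; case: Q => [[x2 y2]|] // o1 o2.
have [h|h] := boolP ((x1 == x2) && (y1 + y2 == 0)); first by rewrite /add_ec h.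
have [l sl] := slope_exists o1 o2 h.
by rewrite (add_slope h sl); apply: on_third o1 sl.
Qed.

Lemma on_opp P : on_ec P -> on_ec (opp_ec P).
Proof. by case: P => [[x y]|] //= ; rewrite sqrrN. Qed.

Lemma add_ecC P Q : on_ec P -> on_ec Q -> add_ec P Q = add_ec Q P.
Proof.
case: P => [[x1 y1]|] //; case: Q => [[x2 y2]|] // o1 o2.
have hC : (x2 == x1) && (y2 + y1 == 0) = (x1 == x2) && (y1 + y2 == 0).
  by rewrite eq_sym addrC.
have [h|h] := boolP ((x1 == x2) && (y1 + y2 == 0)); first by rewrite /= hC h.
have [l sl] := slope_exists o1 o2 h.
rewrite (add_slope h sl) (add_slope _ (is_slopeC sl)) ?hC //.
case: sl => s1 _; rewrite /third; congr (Some (_, _)); first by ring.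
have -> : y2 = y1 + l * (x2 - x1) by rewrite -s1; ring.
by ring.
Qed.

Lemma addN_ec P : add_ec (opp_ec P) P = None.
Proof. by case: P => [[x y]|] //=; rewrite eqxx addNr eqxx. Qed.

Lemma opp_ecK P : opp_ec (opp_ec P) = P.
Proof. by case: P => [[x y]|] //=; rewrite opprK. Qed.

Lemma add_ec0 P : add_ec P None = P. Proof. by case: P => [[]|]. Qed.

(** Cancellation comes before associativity, whose degenerate cases reduce to it. The line of slope
    [l] through -P and R, once reflected, is the line of slope [- l] through P and -P + R. *)
Lemma add_ecNK P R : on_ec P -> on_ec R -> add_ec P (add_ec (opp_ec P) R) = R.
Proof.
move=> oP oR; have oN := on_opp oP.
case: R oR => [[r yr]|] oR; last by rewrite add_ec0 -{1}(opp_ecK P) addN_ec.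
case: P oP oN => [[p yp]|] // oP; rewrite [opp_ec _]/= => oN.
have [h|h] := boolP ((p == r) && (- yp + yr == 0)).
  rewrite /= h; case/andP: h => /eqP -> ; rewrite addrC subr_eq0 => /eqP ->.
  by [].
have [l sl] := slope_exists oN oR h.
rewrite (add_slope h sl) {1}/third.
case: (sl) => s1 s2; set n := l ^+ 2 - p - r.
have er : yr = l * (r - p) - yp by rewrite -s1; ring.
have eA : A = l * (- yp + yr) - p ^+ 2 - p * r - r ^+ 2 by rewrite s2; ring.
(* If -P + R = -P, the line meets the curve twice at a point with y = 0; a line that is not vertical
   does so only at a singular point. *)
have h2 : ~~ ((p == n) && (yp + - (l * (n - p) + - yp) == 0)).
  apply/negP => /andP[/eqP e /eqP e2].
  have y0 : yp = 0.
    apply/eqP; have /eqP : 2%:R * yp = 0 by rewrite -e2 -e; ring.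
    by rewrite mulf_eq0 (negbTE two_neq0).
  have f0 : p ^+ 3 + A * p + B = 0 by move/eqP: oP => <-; rewrite y0 expr0n.
  apply: (singular_contra f0); rewrite eA er y0.
  have -> : r = l ^+ 2 - p - p by rewrite {2}e /n; ring.
  by ring.
rewrite (@add_slope (- l)) //.
  by rewrite /third /n; congr (Some (_, _)); [ring | rewrite er; ring].
by split; [rewrite /n; ring | rewrite eA er /n; ring].
Qed.

Lemma add_ecKN P R : on_ec P -> on_ec R -> add_ec (add_ec R P) (opp_ec P) = R.
Proof.
move=> oP oR; have oN := on_opp oP.
rewrite (add_ecC oR oP) add_ecC ?on_add // -{2}(opp_ecK P).
by rewrite add_ecNK.
Qed.

(** The boolean condition says P + Q = -R, so that the three points are collinear and one slope
    serves both pairs. It excludes the degenerate outer sums in [add_ecA]. *)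
Lemma third_opp l p yp q yq r yr :
  is_slope l p yp q yq -> (l ^+ 2 - p - q == r) && (- (l * (l ^+ 2 - p - q - p) + yp) + yr == 0) ->
  is_slope l q yq r yr.
Proof.
move=> [s1 s2] /andP[/eqP <-]; rewrite addrC subr_eq0 => /eqP ->.
have e2 : yq = yp + l * (q - p) by rewrite -s1; ring.
have eA : A = l * (yp + yq) - p ^+ 2 - p * q - q ^+ 2 by rewrite s2; ring.
by split; [rewrite e2 | rewrite eA e2]; ring.
Qed.

(** Let [l] and [m] be the slopes of PQ and QR. If they are equal, either P = R and commutativity
    suffices, or the three points are collinear and both sides are the origin. If they differ, the
    outer slopes are [k - l] and [k - m], and both sides are compared as rational functions. *)
Lemma add_ecA P Q R : on_ec P -> on_ec Q -> on_ec R ->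
  add_ec P (add_ec Q R) = add_ec (add_ec P Q) R.
Proof.
case: P => [[p yp]|] // oP; case: Q => [[q yq]|] // oQ; case: R => [[r yr]|] // oR;
  last by rewrite !add_ec0.
have [h|h1] := boolP ((p == q) && (yp + yq == 0)).
  rewrite [in RHS]/add_ec h; case/andP: h => /eqP eq; rewrite addr_eq0 => /eqP ey.
  have -> : Some (q, yq) = opp_ec (Some (p, yp)) by rewrite /= eq ey opprK.
  by rewrite add_ecNK.
have [h|h2] := boolP ((q == r) && (yq + yr == 0)).
  have -> : add_ec (Some (q, yq)) (Some (r, yr)) = None by rewrite /= h.
  case/andP: h => /eqP eq; rewrite addrC addr_eq0 => /eqP ey.
  have -> : Some (r, yr) = opp_ec (Some (q, yq)) by rewrite /= eq ey.
  by rewrite add_ecKN.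
have [l sl] := slope_exists oP oQ h1.
have [m sm] := slope_exists oQ oR h2.
have oN := on_add oP oQ; have oM := on_add oQ oR.
rewrite (add_slope h1 sl) in oN *; rewrite (add_slope h2 sm) in oM *.
case: (sl) => s1 s2; case: (sm) => t1 t2.
have ep : yp = yq - l * (q - p) by rewrite -s1; ring.
have er : yr = yq + m * (r - q) by rewrite -t1; ring.
have eA : A = l * (yp + yq) - p ^+ 2 - p * q - q ^+ 2 by rewrite s2; ring.
have [elm|nlm] := eqVneq l m.
  subst m.
  have /eqP : (p - r) * (l ^+ 2 - p - q - r) = 0.
    have : l * (yq + yr) - l * (yp + yq) =
      (q ^+ 2 + q * r + r ^+ 2 + A) - (p ^+ 2 + p * q + q ^+ 2 + A) by rewrite s2 t2.
    rewrite ep er => h.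
    transitivity ((q ^+ 2 + q * r + r ^+ 2 + A - (p ^+ 2 + p * q + q ^+ 2 + A)) -
      (l * (yq + (yq + l * (r - q))) - l * (yq - l * (q - p) + yq))); first by ring.
    by rewrite h subrr.
  rewrite mulf_eq0 subr_eq0 => /orP[/eqP e|/eqP e].
    subst r; have ey : yr = yp by rewrite ep er; ring.
    clear er; subst yr; rewrite (add_ecC oP oM) -(add_slope h2 sm) -(add_slope h1 sl).
    by rewrite (add_ecC oP oQ).
  have e' : r = l ^+ 2 - p - q by apply/eqP; rewrite eq_sym -subr_eq0 e.
  rewrite /third /= ifT; last first.
    apply/andP; split; apply/eqP; first by rewrite e'; ring.
    by rewrite ep e'; ring.
  rewrite ifT //; apply/andP; split; apply/eqP; first by rewrite e'.
  by rewrite er ep e'; ring.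
have d0 : l - m != 0 by rewrite subr_eq0.
have hN : ~~ ((l ^+ 2 - p - q == r) && (- (l * (l ^+ 2 - p - q - p) + yp) + yr == 0)).
  apply: contraNN nlm => h; apply/eqP.
  exact: slope_uniq h2 (third_opp sl h) sm.
have hM : ~~ ((p == m ^+ 2 - q - r) && (yp + - (m * (m ^+ 2 - q - r - q) + yq) == 0)).
  apply: contraNN nlm => h; apply/eqP; apply/esym.
  have sm' := is_slopeC sm.
  have h' : (m ^+ 2 - r - q == p) && (- (m * (m ^+ 2 - r - q - r) + yr) + yp == 0).
    have -> : m ^+ 2 - r - q = m ^+ 2 - q - r by ring.
    rewrite eq_sym [_ + yp]addrC.
    have -> : m * (m ^+ 2 - q - r - r) + yr = m * (m ^+ 2 - q - r - q) + yq by rewrite er; ring.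
    exact: h.
  exact: slope_uniq h1 (is_slopeC (third_opp sm' h')) sl.
pose k := (p - r) / (l - m).
(* The difference of the two second slope equations is linear in [yq]. Once it is solved, everything
   is rational in [p], [q], [r], [l], [m], with no relation left between them, so [field]
   applies. *)
have eyq : yq = ((p ^+ 2 + p * q - q * r - r ^+ 2) - l ^+ 2 * (p - q) + m ^+ 2 * (r - q))
   / (2%:R * (l - m)).
  have : l * (yp + yq) - m * (yq + yr) =
      (p ^+ 2 + p * q + q ^+ 2 + A) - (q ^+ 2 + q * r + r ^+ 2 + A) by rewrite s2 t2.
  rewrite ep er => h.
  apply: (@mulIf _ (2%:R * (l - m))); first by rewrite mulf_neq0 ?two_neq0.
  rewrite mulfVK ?mulf_neq0 ?two_neq0 //.
  transitivity (l * (yq - l * (q - p) + yq) - m * (yq + (yq + m * (r - q)))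
     - l ^+ 2 * (p - q) + m ^+ 2 * (r - q)); first by ring.
  by rewrite h; ring.
rewrite (@add_slope (k - l) _ _ r yr) //; last first.
  split; rewrite ?eA ep er ?eyq /k; field; by rewrite d0 two_neq0.
rewrite (@add_slope (k - m) p yp) //; last first.
  split; rewrite ?eA ep ?eyq /k; field; by rewrite d0 two_neq0.
rewrite /third; congr (Some (_, _)); rewrite ?ep ?eyq /k; field; by rewrite ?d0 ?two_neq0.
Qed.

(** * The points as an abelian group, and the action of morphisms on them *)

Record point := Point { pval :> option (F * F); _ : on_ec pval }.
HB.instance Definition _ := [isSub for pval].
HB.instance Definition _ := [Choice of point by <:].

Definition pt_zero := @Point None isT.
Definition pt_oppr (P : point) := Point (on_opp (valP P)).
Definition pt_addr (P Q : point) := Point (on_add (valP P) (valP Q)).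

Fact pt_addrA : associative pt_addr.
Proof. by move=> P Q R; apply: val_inj; apply: add_ecA; apply: valP. Qed.
Fact pt_addrC : commutative pt_addr.
Proof. by move=> P Q; apply: val_inj; apply: add_ecC; apply: valP. Qed.
Fact pt_add0r : left_id pt_zero pt_addr.
Proof. by move=> P; apply: val_inj. Qed.
Fact pt_addNr : left_inverse pt_zero pt_oppr pt_addr.
Proof. by move=> P; apply: val_inj; apply: addN_ec. Qed.
HB.instance Definition _ := GRing.isZmodule.Build point pt_addrA pt_addrC pt_add0r pt_addNr.

Lemma pvalD (P Q : point) : pval (P + Q) = add_ec (pval P) (pval Q). Proof. by []. Qed.
Lemma pvalN (P : point) : pval (- P) = opp_ec (pval P). Proof. by []. Qed.

End GroupLaw.

Definition map_ec (F : Type) (s : F -> F) (P : option (F * F)) : option (F * F) :=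
  omap (fun xy => (s xy.1, s xy.2)) P.

Section PointMap.
Variable F : fieldType.
Variable E : curve F.

(* Only meaningful when s fixes the coefficients of E: otherwise an image
   that leaves the curve is replaced by the origin. *)
Definition pt_map (s : F -> F) (P : point E) : point E := insubd (0 : point E) (map_ec s (pval P)).

Section Morphism.
Variable s : {rmorphism F -> F}.
Hypotheses (sA : s (cA E) = cA E) (sB : s (cB E) = cB E).

Lemma on_map_ec P : on_ec E P -> on_ec E (map_ec s P).
Proof.
case: P => [[x y]|] //= /eqP h; apply/eqP.
by rewrite -rmorphXn h !rmorphD rmorphM rmorphXn sA sB.
Qed.

Lemma pval_map P : pval (pt_map s P) = map_ec s (pval P).
Proof. by rewrite /pt_map -[LHS]/(val _) val_insubd on_map_ec //; apply: valP. Qed.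

Lemma map_third l x1 y1 x2 : map_ec s (third l x1 y1 x2) = third (s l) (s x1) (s y1) (s x2).
Proof. by rewrite /third /= !(rmorphXn, rmorphN, rmorphD, rmorphM). Qed.

Lemma map_add_ec P Q : map_ec s (add_ec E P Q) = add_ec E (map_ec s P) (map_ec s Q).
Proof.
case: P => [[x1 y1]|] //; case: Q => [[x2 y2]|] //=.
rewrite -rmorphD fmorph_eq0 (inj_eq (fmorph_inj s)).
case: ifP => // _.
by case: ifP => _; rewrite map_third; congr (third _ _ _ _);
  rewrite fmorph_div ?rmorphB // !(rmorphXn, rmorph_nat, rmorphD, rmorphM) sA.
Qed.

Lemma pt_mapD : {morph pt_map s : P Q / P + Q}.
Proof. by move=> P Q; apply: val_inj; rewrite /= pval_map !pvalD map_add_ec !pval_map. Qed.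

Lemma pt_map0 : pt_map s 0 = 0.
Proof. by apply: (addrI (pt_map s 0)); rewrite -pt_mapD !addr0. Qed.

Lemma pt_mapN : {morph pt_map s : P / - P}.
Proof. by move=> P; apply/eqP; rewrite -addr_eq0 -pt_mapD addNr pt_map0. Qed.

Lemma pt_mapMz z : {morph pt_map s : P / P *~ z}.
Proof.
have hn n P : pt_map s (P *+ n) = pt_map s P *+ n.
  by elim: n => [|n IH]; rewrite ?mulr0n ?pt_map0 // !mulrS pt_mapD IH.
by case: z => n P; rewrite ?NegzE -?pmulrn ?nmulrn ?pt_mapN hn.
Qed.

Lemma pt_map_sum (I : Type) (r : seq I) (Q : I -> point E) :
  pt_map s (\sum_(i <- r) Q i) = \sum_(i <- r) pt_map s (Q i).
Proof.
by elim: r => [|i r IH]; rewrite ?big_nil ?pt_map0 // !big_cons pt_mapD IH.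
Qed.

End Morphism.

End PointMap.

(** * Valuation rings and the formal group *)

Record valring (F : fieldType) (O : F -> Prop) : Prop := {
  vr1 : O 1;
  vrB : forall a b, O a -> O b -> O (a - b);
  vrM : forall a b, O a -> O b -> O (a * b);
  vrV : forall a, O a \/ O a^-1;
  vr_half : ~ O 2%:R^-1 }.

Section Valuation.
Variables (F : fieldType) (O : F -> Prop).
Hypothesis vO : valring O.

(** Stands for v(a) >= v(m); no value group is introduced. *)
Definition dv (m a : F) : Prop := exists2 c, O c & a = m * c.

Lemma vr0 : O 0. Proof. by rewrite -(subrr 1); apply: (vrB vO); apply: (vr1 vO). Qed.
Lemma vrN a : O a -> O (- a). Proof. by rewrite -sub0r; apply: (vrB vO) vr0. Qed.
Lemma vrD a b : O a -> O b -> O (a + b).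
Proof. by move=> ha hb; rewrite -[b]opprK; apply: (vrB vO) => //; apply: vrN. Qed.
Lemma vrX a n : O a -> O (a ^+ n).
Proof. by move=> ha; elim: n => [|n IH]; rewrite ?expr0 ?exprS; [apply: vr1 | apply: vrM]. Qed.
Lemma vr_nat n : O n%:R.
Proof. by elim: n => [|n IH]; [apply: vr0 | rewrite mulrS; apply: vrD => //; apply: (vr1 vO)]. Qed.
Lemma vr_sum (I : Type) (r : seq I) (P : pred I) (f : I -> F) :
  (forall i, O (f i)) -> O (\sum_(i <- r | P i) f i).
Proof. by move=> h; apply: big_ind => //; [apply: vr0 | apply: vrD]. Qed.

Lemma two_vr_neq0 : 2%:R != 0 :> F.
Proof. by apply/negP => /eqP h; apply: (vr_half vO); rewrite h invr0; apply: vr0. Qed.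

Lemma dvD m a b : dv m a -> dv m b -> dv m (a + b).
Proof. by case=> c hc -> [d hd ->]; exists (c + d); rewrite ?mulrDr //; apply: vrD. Qed.
Lemma dvN m a : dv m a -> dv m (- a).
Proof. by case=> c hc ->; exists (- c); rewrite ?mulrN //; apply: vrN. Qed.
Lemma dvB m a b : dv m a -> dv m b -> dv m (a - b).
Proof. by move=> h1 h2; apply: dvD => //; apply: dvN. Qed.
Lemma dv0 m : dv m 0. Proof. by exists 0; rewrite ?mulr0 //; apply: vr0. Qed.
Lemma dvM m n a b : dv m a -> dv n b -> dv (m * n) (a * b).
Proof. by case=> c hc -> [d hd ->]; exists (c * d); [apply: (vrM vO) | rewrite mulrACA]. Qed.
Lemma dvMr m a b : dv m a -> O b -> dv m (a * b).
Proof. by case=> c hc -> hb; exists (c * b); [apply: (vrM vO) | rewrite mulrA]. Qed.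
Lemma dvMl m a b : O b -> dv m a -> dv m (b * a).
Proof. by move=> hb ha; rewrite mulrC; apply: dvMr. Qed.
Lemma dv_trans m n a : dv m n -> dv n a -> dv m a.
Proof. by case=> c hc -> [d hd ->]; exists (c * d); [apply: (vrM vO) | rewrite mulrA]. Qed.
Lemma dv_refl m : dv m m. Proof. by exists 1; rewrite ?mulr1 //; apply: (vr1 vO). Qed.
Lemma dv_vr m a : O m -> dv m a -> O a.
Proof. by move=> hm [c hc ->]; apply: (vrM vO). Qed.
Lemma dv_sum (I : Type) (r : seq I) (P : pred I) (f : I -> F) m :
  (forall i, dv m (f i)) -> dv m (\sum_(i <- r | P i) f i).
Proof. by move=> h; apply: big_ind => //; [apply: dv0 | apply: dvD]. Qed.
Lemma dvX m a n : dv m a -> dv (m ^+ n) (a ^+ n).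
Proof. by case=> c hc ->; exists (c ^+ n); [apply: vrX | rewrite exprMn]. Qed.
Lemma dv_exp2 j k a : (j <= k)%N -> dv (2%:R ^+ k) a -> dv (2%:R ^+ j) a.
Proof.
move=> h; apply: dv_trans; exists (2%:R ^+ (k - j)); first by apply: vrX; apply: vr_nat.
by rewrite -exprD subnKC.
Qed.
Lemma dvV m a : m != 0 -> dv m a <-> O (a / m).
Proof.
move=> m0; split=> [[c hc ->]|h]; first by rewrite mulrC mulKf.
by exists (a / m) => //; rewrite mulrC divfK.
Qed.
Lemma dv_total a b : dv a b \/ dv b a.
Proof.
have [->|a0] := eqVneq a 0; first by right; apply: dv0.
have [->|b0] := eqVneq b 0; first by left; apply: dv0.
case: (vrV vO (b / a)) => h; [left | right]; apply/dvV => //.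
by rewrite invfM invrK mulrC in h.
Qed.

(** Put u = 1 + 2 a. As 1/2 is not in [O], neither is u/2, so 2/u is, and 1/u = 1 - (2/u) a. *)
Lemma unit_vr a : O a -> 1 + 2%:R * a != 0 /\ O (1 + 2%:R * a)^-1.
Proof.
move=> ha; set u := 1 + _.
have n2 : ~ O (u / 2%:R).
  move=> h; apply: (vr_half vO).
  have -> : 2%:R^-1 = u / 2%:R - a by rewrite /u; field; apply: two_vr_neq0.
  exact: (vrB vO).
have u0 : u != 0 by apply/negP => /eqP e; apply: n2; rewrite e mul0r; apply: vr0.
split=> //; case: (vrV vO (u / 2%:R)) => // h.
rewrite invfM invrK in h.
have -> : u^-1 = 1 - u^-1 * 2%:R * a.
  transitivity (u^-1 * (u - 2%:R * a)); first by rewrite /u addrK mulr1.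
  by rewrite mulrBr mulVf // mulrA.
by apply: (vrB vO); [apply: (vr1 vO) | apply: (vrM vO)].
Qed.

Lemma unit_dv u : dv 2%:R (u - 1) -> u != 0 /\ O u^-1.
Proof. case=> c hc e; have -> : u = 1 + 2%:R * c by rewrite -e; ring.
exact: unit_vr. Qed.

Lemma not_dv_exp2S k : ~ dv (2%:R ^+ k.+1) (2%:R ^+ k).
Proof.
move=> [c hc e]; apply: (vr_half vO).
have p0 : 2%:R ^+ k != 0 :> F by rewrite expf_neq0 // two_vr_neq0.
have e1 : 2%:R * c = 1 by apply: (mulfI p0); rewrite mulr1 {2}e exprSr mulrA.
suff -> : 2%:R^-1 = c by [].
by apply: (mulfI two_vr_neq0); rewrite e1 mulfV // two_vr_neq0.
Qed.

Lemma vr_odd n : odd n -> (n%:R : F) != 0 /\ O n%:R^-1.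
Proof.
move=> on; apply: unit_dv; exists (n./2)%:R; first exact: vr_nat.
by rewrite -{1}(odd_double_half n) on -mul2n natrD natrM /=; ring.
Qed.

Lemma dv_max (n : nat) (r : 'I_n.+1 -> F) : exists i, forall j, dv (r i) (r j).
Proof.
elim: n r => [|n IH] r.
  exists ord0 => j; have -> : j = ord0 by apply/val_inj; case: j => [[]].
  exact: dv_refl.
have [i hi] := IH (fun j => r (lift ord0 j)).
have ex (j : 'I_n.+2) : j = ord0 \/ exists k, j = lift ord0 k.
  by case: (unliftP ord0 j) => [k ->|->]; [right; exists k | left].
case: (dv_total (r ord0) (r (lift ord0 i))) => h.
  exists ord0 => j; case: (ex j) => [->|[k ->]]; first exact: dv_refl.
  exact: dv_trans h (hi k).
by exists (lift ord0 i) => j; case: (ex j) => [->|[k ->]].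
Qed.

End Valuation.

(** * The formal group near the origin *)

Section FormalGroup.
Variables (F : fieldType) (O : F -> Prop) (E : curve F).
Hypothesis vO : valring O.
Local Notation A := (cA E).
Local Notation B := (cB E).
Hypotheses (OA : O A) (OB : O B).
Local Notation dv := (dv O).

Definition tpar (P : option (F * F)) : F := if P is Some (x, y) then x / y else 0.

(** A small x / y alone does not mean closeness to the origin, since x may vanish; the clause on 1 /
    y excludes this. *)
Definition near0 (m : F) (P : option (F * F)) : Prop :=
  if P is Some (x, y) then [/\ y != 0, dv m (x / y) & dv 2%:R y^-1] else True.

Lemma unit_1sub a : dv 2%:R a -> 1 - a != 0 /\ O (1 - a)^-1.
Proof.
move=> h; apply: (unit_dv vO); have -> : 1 - a - 1 = - a by ring.
exact: dvN.
Qed.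

Lemma tw_eq x y : y != 0 -> on_ec E (Some (x, y)) ->
  y^-1 = (x / y) ^+ 3 + A * (x / y) * y^-1 ^+ 2 + B * y^-1 ^+ 3.
Proof.
move=> y0 /eqP h.
transitivity ((x ^+ 3 + A * x + B) * y^-1 ^+ 3); last by ring.
by rewrite -h; field.
Qed.

(** The equation reads w (1 - w (A t + B w)) = t^3, and the second factor on the left is a unit. *)
Lemma w_cube (t w m : F) : dv 2%:R m -> O m -> dv m t -> dv 2%:R w ->
  w = t ^+ 3 + A * t * w ^+ 2 + B * w ^+ 3 -> dv (m ^+ 3) w.
Proof.
move=> m2 Om ht hw e.
have Ot : O t by apply: dv_vr ht.
have Ow : O w by apply: dv_vr hw => //; apply: vr_nat.
have [u0 uV] : 1 - w * (A * t + B * w) != 0 /\ O (1 - w * (A * t + B * w))^-1.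
  apply: unit_1sub; apply: dvMr => //.
  by apply: (vrD vO); apply: (vrM vO).
have -> : w = t ^+ 3 * (1 - w * (A * t + B * w))^-1.
  by apply: (mulIf u0); rewrite mulfVK // [in LHS]mulrBr mulr1 {1}e; ring.
by apply: dvMr => //; apply: dvX.
Qed.

(** Vieta's formulas for the cubic in t obtained by substituting w = a t + b in the chart equation,
    with leading coefficient [k]. The second hypothesis is the divided difference of that equation,
    which makes sense for tangents too. The two conclusions are what the abscissa t / w of the sum
    requires. *)
Lemma line_tw a b t1 t2 t3 :
  let w1 := a * t1 + b in let w2 := a * t2 + b in let w3 := a * t3 + b in
  let k := 1 + A * a ^+ 2 + B * a ^+ 3 in
  w1 = t1 ^+ 3 + A * t1 * w1 ^+ 2 + B * w1 ^+ 3 ->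
  a * (1 - A * t1 * (w1 + w2) - B * (w1 ^+ 2 + w1 * w2 + w2 ^+ 2)) =
     t1 ^+ 2 + t1 * t2 + t2 ^+ 2 + A * w2 ^+ 2 ->
  k * (t1 + t2 + t3) = - (2%:R * A * a * b + 3%:R * B * a ^+ 2 * b) ->
  k * (w1 * w2 * w3) = b ^+ 3 /\
  k * (t1 * w2 * w3 + t2 * w1 * w3 + t3 * w1 * w2) = a ^+ 2 * b.
Proof.
move=> w1 w2 w3 k h1 h2 h3.
have e2 : k * (t1 * t2 + t1 * t3 + t2 * t3) = A * b ^+ 2 + 3%:R * B * a * b ^+ 2 - a.
  transitivity (A * b ^+ 2 + 3%:R * B * a * b ^+ 2 - a
    + (t1 + t2) * (k * (t1 + t2 + t3) - - (2%:R * A * a * b + 3%:R * B * a ^+ 2 * b))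
    - ((t1 ^+ 2 + t1 * t2 + t2 ^+ 2 + A * w2 ^+ 2) -
       (a * (1 - A * t1 * (w1 + w2) - B * (w1 ^+ 2 + w1 * w2 + w2 ^+ 2))))).
    by rewrite /k /w1 /w2; ring.
  by rewrite h3 h2; ring.
have e3 : k * (t1 * t2 * t3) = b - B * b ^+ 3.
  transitivity (b - B * b ^+ 3
    + (t1 ^+ 3 + A * t1 * w1 ^+ 2 + B * w1 ^+ 3 - w1)
    - t1 * ((t1 ^+ 2 + t1 * t2 + t2 ^+ 2 + A * w2 ^+ 2) -
       (a * (1 - A * t1 * (w1 + w2) - B * (w1 ^+ 2 + w1 * w2 + w2 ^+ 2))))
    + t1 * t2 * (k * (t1 + t2 + t3) - - (2%:R * A * a * b + 3%:R * B * a ^+ 2 * b))).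
    by rewrite /k /w1 /w2; ring.
  by rewrite h3 h2 -h1; ring.
split.
  transitivity (a ^+ 3 * (k * (t1 * t2 * t3)) + a ^+ 2 * b * (k * (t1 * t2 + t1 * t3 + t2 * t3))
    + a * b ^+ 2 * (k * (t1 + t2 + t3)) + k * b ^+ 3); first by rewrite /w1 /w2 /w3; ring.
  by rewrite e2 e3 h3 /k; ring.
transitivity (3%:R * a ^+ 2 * (k * (t1 * t2 * t3)) + 2%:R * a * b * (k * (t1 * t2 + t1 * t3 + t2 * t3))
    + b ^+ 2 * (k * (t1 + t2 + t3))); first by rewrite /w1 /w2 /w3; ring.
by rewrite e2 e3 h3; ring.
Qed.

(* In the chart t = x/y, w = 1/y around the origin, P + Q is the opposite of the
   third intersection point of the curve with the line w = a t + b through P and Q. *)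
Lemma near0_add m P Q : dv 2%:R m -> on_ec E P -> on_ec E Q -> near0 m P -> near0 m Q ->
  near0 m (add_ec E P Q) /\ dv (m ^+ 2) (tpar (add_ec E P Q) - tpar P - tpar Q).
Proof.
move=> m2; have O2 := vr_nat vO 2; have Om : O m by apply: dv_vr m2.
case: P => [[x1 y1]|] oP; last by case: Q => [[x2 y2]|] /= *; rewrite ?subr0 ?subrr; split=> //; apply: dv0.
case: Q => [[x2 y2]|] oQ; last by move=> /= *; rewrite subr0 subrr; split=> //; apply: dv0.
move=> nP nQ; case: (nP) => y10 ht1 hw1; case: (nQ) => y20 ht2 hw2.
have eP := tw_eq y10 oP; have eQ := tw_eq y20 oQ.
have [h|h] := boolP ((x1 == x2) && (y1 + y2 == 0)).
  rewrite /= h; split=> //; case/andP: h => /eqP ->; rewrite addr_eq0 => /eqP ->.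
  have -> : 0 - x2 / - y2 - x2 / y2 = 0 by rewrite invrN mulrN sub0r opprK subrr.
  exact: dv0.
set t1 := x1 / y1 in ht1 eP *; set w1 := y1^-1 in hw1 eP *.
set t2 := x2 / y2 in ht2 eQ *; set w2 := y2^-1 in hw2 eQ *.
have c1 := w_cube m2 Om ht1 hw1 eP; have c2 := w_cube m2 Om ht2 hw2 eQ.
have w10 : w1 != 0 by rewrite invr_eq0.
have w20 : w2 != 0 by rewrite invr_eq0.
have Ot1 : O t1 by apply: dv_vr ht1. 
have Ot2 : O t2 by apply: dv_vr ht2.
have Ow1 : O w1 by apply: dv_vr hw1.
have Ow2 : O w2 by apply: dv_vr hw2.
have m23 : dv (m ^+ 2) (m ^+ 3) by exists m => //; rewrite exprSr.
have [d0 dV] : 1 - (A * t1 * (w1 + w2) + B * (w1 ^+ 2 + w1 * w2 + w2 ^+ 2)) != 0 /\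
     O (1 - (A * t1 * (w1 + w2) + B * (w1 ^+ 2 + w1 * w2 + w2 ^+ 2)))^-1.
  apply: unit_1sub; apply: dvD => //; apply: dvMl => //; try by apply: (vrM vO).
    by apply: dvD.
  apply: dvD => //; first apply: dvD => //; rewrite ?expr2; by apply: dvMr.
set d := 1 - _ in d0 dV.
pose a := (t1 ^+ 2 + t1 * t2 + t2 ^+ 2 + A * w2 ^+ 2) / d.
pose b := w1 - a * t1.
have ha : dv (m ^+ 2) a.
  apply: dvMr => //; apply: dvD => //; last first.
    apply: dvMl => //; apply: dv_trans m23 _ => //; rewrite expr2; exact: dvMr.
  by apply: dvD => //; first apply: dvD => //; rewrite ?expr2; apply: dvM.
have Oa : O a by apply: dv_vr ha => //; apply: vrX.
have h12 : a * (1 - A * t1 * (w1 + w2) - B * (w1 ^+ 2 + w1 * w2 + w2 ^+ 2)) =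
     t1 ^+ 2 + t1 * t2 + t2 ^+ 2 + A * w2 ^+ 2.
  have -> : 1 - A * t1 * (w1 + w2) - B * (w1 ^+ 2 + w1 * w2 + w2 ^+ 2) = d by rewrite /d; ring.
  by rewrite /a mulfVK.
have ew1 : w1 = a * t1 + b by rewrite /b; ring.
have ew2 : w2 = a * t2 + b.
  apply/eqP; rewrite -subr_eq0; apply/eqP; apply: (mulIf d0); rewrite mul0r.
  have -> : (w2 - (a * t2 + b)) * d = (w2 - w1) * d - (a * (1 - A * t1 * (w1 + w2) - B * (w1 ^+ 2 + w1 * w2 + w2 ^+ 2))) * (t2 - t1).
    by rewrite /b /d; ring.
  rewrite h12 /d.
  transitivity ((w2 - (t2 ^+ 3 + A * t2 * w2 ^+ 2 + B * w2 ^+ 3)) - (w1 - (t1 ^+ 3 + A * t1 * w1 ^+ 2 + B * w1 ^+ 3))).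
    by ring.
  by rewrite -eP -eQ !subrr.
have hb : dv (m ^+ 3) b.
  apply: dvB => //; rewrite exprSr; exact: dvM.
have Ob : O b by apply: dv_vr hb => //; apply: vrX.
pose k := 1 + A * a ^+ 2 + B * a ^+ 3.
have dm2 : dv 2%:R (m ^+ 2) by rewrite expr2; apply: dvMr.
have d2a : dv 2%:R a by apply: dv_trans ha.
have [k0 kV] : k != 0 /\ O k^-1.
  apply: (unit_dv vO); have -> : k - 1 = a * (A * a + B * a ^+ 2) by rewrite /k; ring.
  by apply: dvMr => //; apply: (vrD vO); apply: (vrM vO) => //; apply: vrX.
(* By Vieta the third root is [t3 = - t1 - t2 - err]. The sum P + Q has parameter [- t3], so [err]
   is the defect of additivity, and it is divisible by [a]. *)
pose err := (2%:R * A * a * b + 3%:R * B * a ^+ 2 * b) / k.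
pose t3 := - t1 - t2 - err.
pose w3 := a * t3 + b.
have h3 : k * (t1 + t2 + t3) = - (2%:R * A * a * b + 3%:R * B * a ^+ 2 * b).
  by rewrite /t3 /err; field.
have [kw kx] : k * (w1 * w2 * w3) = b ^+ 3 /\
  k * (t1 * w2 * w3 + t2 * w1 * w3 + t3 * w1 * w2) = a ^+ 2 * b.
  rewrite ew1 ew2; apply: line_tw => //; first by rewrite -ew1.
  by rewrite -ew1 -ew2.
have herr : dv (m ^+ 2) err.
  apply: dvMr => //; have -> : 2%:R * A * a * b + 3%:R * B * a ^+ 2 * b =
     a * (b * (2%:R * A + 3%:R * B * a)) by ring.
  apply: dvMr => //; apply: (vrM vO) => //; apply: (vrD vO); apply: (vrM vO) => //.
  by apply: (vrM vO) => //; apply: vr_nat.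
have dmm : dv m (m ^+ 2) by exists m => //.
have ht3 : dv m t3.
  by apply: dvB => //; [apply: dvB => //; apply: dvN | apply: dv_trans herr].
(* With [b = 0] the line passes through the origin, which forces Q = -P, a case already treated. *)
have b0 : b != 0.
  apply/negP => /eqP b0; have a0 : a != 0.
    by apply: contraNneq w10 => a0; rewrite ew1 a0 b0 mul0r addr0.
  have w3z : w3 = 0.
    move/eqP: kw; rewrite b0 expr0n /= mulf_eq0 (negbTE k0) /= mulf_eq0 => /orP[|/eqP //].
    by rewrite mulf_eq0 (negbTE w10) (negbTE w20).
  have t3z : t3 = 0.
    by apply/eqP; move/eqP: w3z; rewrite /w3 b0 addr0 mulf_eq0 (negbTE a0).
  have t12 : t1 + t2 = 0.
    by apply: (mulfI k0); move: h3; rewrite t3z b0 !mulr0 !addr0 oppr0.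
  have x1E : x1 = t1 / w1 by rewrite /t1 /w1 invrK divfK.
  have x2E : x2 = t2 / w2 by rewrite /t2 /w2 invrK divfK.
  have t10 : t1 != 0 by apply: contraNneq w10 => t0; rewrite ew1 t0 b0 mulr0 addr0.
  have t20 : t2 != 0 by apply: contraNneq w20 => t0; rewrite ew2 t0 b0 mulr0 addr0.
  have ex : x1 = x2.
    by rewrite x1E x2E ew1 ew2 b0; rewrite !addr0; field; rewrite a0 t10 t20.
  move: h; rewrite ex eqxx /=; case: eqP => // ny _; apply: ny.
  have y1E : y1 = w1^-1 by rewrite /w1 invrK.
  have y2E : y2 = w2^-1 by rewrite /w2 invrK.
  have et : t2 = - t1 by apply/eqP; rewrite -addr_eq0 addrC t12.
  rewrite y1E y2E ew1 ew2 b0 et !addr0 mulrN invrN subrr //.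
have w30 : w3 != 0.
  by apply: contraNneq b0 => w0; have /eqP := kw; rewrite w0 !mulr0 eq_sym expf_eq0.
have x1E : x1 = t1 / w1 by rewrite /t1 /w1 invrK divfK.
have x2E : x2 = t2 / w2 by rewrite /t2 /w2 invrK divfK.
have y1E : y1 = w1^-1 by rewrite /w1 invrK.
have y2E : y2 = w2^-1 by rewrite /w2 invrK.
have v1 : a * t1 + b != 0 by rewrite -ew1.
have v2 : a * t2 + b != 0 by rewrite -ew2.
have v3 : a * t3 + b != 0 by [].
(* In affine coordinates the line w = a t + b is 1 = a x + b y. *)
have sl : is_slope E (- a / b) x1 y1 x2 y2.
  split.
    by rewrite x1E x2E y1E y2E ew1 ew2; field; rewrite v1 v2 b0.
  apply/eqP; rewrite -subr_eq0; apply/eqP.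
  pose G1 := t1 ^+ 3 + A * t1 * w1 ^+ 2 + B * w1 ^+ 3 - w1.
  pose G12 := (t1 ^+ 2 + t1 * t2 + t2 ^+ 2 + A * w2 ^+ 2)
    - a * (1 - A * t1 * (w1 + w2) - B * (w1 ^+ 2 + w1 * w2 + w2 ^+ 2)).
  have z1 : G1 = 0 by rewrite /G1 -eP subrr.
  have z12 : G12 = 0 by rewrite /G12 h12 subrr.
  transitivity (- (w1 * w2 / b) * (G12 / w2 ^+ 3 -
     a * (w1 ^+ 2 + w1 * w2 + w2 ^+ 2) / (w1 * w2) ^+ 3 * G1)); last first.
    by rewrite z1 z12 !(mul0r, mulr0, subr0).
  by rewrite /G1 /G12 x1E x2E y1E y2E ew1 ew2; field; rewrite v1 v2 b0.
have eadd : add_ec E (Some (x1, y1)) (Some (x2, y2)) = Some (t3 / w3, - w3^-1).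
  rewrite (add_slope h sl) /third.
  have ex : (- a / b) ^+ 2 - x1 - x2 = t3 / w3.
    apply/eqP; rewrite -subr_eq0; apply/eqP.
    have n0 : k * (w1 * w2 * w3) != 0 by rewrite kw expf_neq0.
    apply: (mulIf n0); rewrite mul0r.
    have -> : ((- a / b) ^+ 2 - x1 - x2 - t3 / w3) * (k * (w1 * w2 * w3)) =
      (a / b) ^+ 2 * (k * (w1 * w2 * w3)) -
      k * (t1 * w2 * w3 + t2 * w1 * w3 + t3 * w1 * w2).
      by rewrite x1E x2E; field; rewrite w10 w20 w30 b0.
    by rewrite kw kx; field.
  congr (Some (_, _)); first exact: ex.
  by rewrite ex x1E y1E ew1 /w3; field; rewrite v1 v3 b0.
have et : tpar (add_ec E (Some (x1, y1)) (Some (x2, y2))) = t1 + t2 + err.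
  rewrite eadd /=; transitivity (- t3); first by rewrite invrN invrK mulrN divfK.
  by rewrite /t3; ring.
rewrite et; split; last first.
  by rewrite [tpar (Some (x1, y1))]/= [tpar (Some (x2, y2))]/= -/t1 -/t2; have -> : t1 + t2 + err - t1 - t2 = err by ring.
rewrite eadd /near0; split.
- by rewrite oppr_eq0 invr_eq0.
- have -> : t3 / w3 / - w3^-1 = - t3 by rewrite invrN invrK mulrN divfK.
  exact: dvN.
rewrite invrN invrK; apply: dvN => //; apply: dvD => //.
  by apply: dvMr => //; apply: dv_vr ht3.
by apply: dv_trans hb => //; apply: dv_trans m23.
Qed.

Lemma near0_opp m P : near0 m P -> near0 m (opp_ec P) /\ tpar (opp_ec P) = - tpar P.
Proof.
case: P => [[x y]|] /=; last by rewrite oppr0.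
by case=> y0 ht hw; rewrite invrN mulrN oppr_eq0; split=> //; split=> //; apply: dvN.
Qed.

Lemma near0_trans m n P : dv m n -> near0 n P -> near0 m P.
Proof. by case: P => [[x y]|] //= h [y0 ht hw]; split=> //; apply: dv_trans ht. Qed.

Lemma near0_tpar m P : near0 m P -> near0 (tpar P) P /\ dv m (tpar P).
Proof.
case: P => [[x y]|] /=; last by split=> //; apply: dv0.
by case=> y0 ht hw; split=> //; split=> //; apply: dv_refl.
Qed.

Lemma near0_tpar_eq0 m P : O m -> on_ec E P -> near0 m P -> tpar P = 0 -> P = None.
Proof.
case: P => [[x y]|] //= Om oP [y0 ht hw] t0; exfalso.
have eP := tw_eq y0 oP.
have Ow : O y^-1 by apply: dv_vr hw => //; apply: vr_nat.
have [u0 _] : 1 - y^-1 * (B * y^-1) != 0 /\ O (1 - y^-1 * (B * y^-1))^-1.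
  by apply: unit_1sub; apply: dvMr => //; apply: (vrM vO).
have : y^-1 * (1 - y^-1 * (B * y^-1)) == 0.
  rewrite mulrBr mulr1 {1}eP t0 expr0n /= mulr0 mul0r !add0r subr_eq0.
  by apply/eqP; ring.
by rewrite mulf_eq0 (negbTE u0) invr_eq0 (negbTE y0).
Qed.

Lemma near0_sum m (I : Type) (r : seq I) (Q : I -> point E) : dv 2%:R m ->
  (forall i, near0 m (pval (Q i))) ->
  near0 m (pval (\sum_(i <- r) Q i)) /\
  dv (m ^+ 2) (tpar (pval (\sum_(i <- r) Q i)) - \sum_(i <- r) tpar (pval (Q i))).
Proof.
move=> m2 hQ; elim: r => [|i r [IH1 IH2]].
  by rewrite !big_nil /= subrr; split=> //; apply: dv0.
rewrite !big_cons.
have [h1 h2] := near0_add m2 (valP (Q i)) (valP (\sum_(j <- r) Q j)) (hQ i) IH1.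
split=> //; have := dvD vO h2 IH2; rewrite [val _]/(pval _) -pvalD.
by congr (dv _ _); ring.
Qed.

Lemma near0_mulrn m (P : point E) n : dv 2%:R m -> near0 m (pval P) ->
  near0 m (pval (P *+ n)) /\ dv (m ^+ 2) (tpar (pval (P *+ n)) - n%:R * tpar (pval P)).
Proof.
move=> m2 h; have := @near0_sum m _ (iota 0 n) (fun=> P) m2 (fun=> h).
by rewrite !big_const_seq count_predT size_iota !iter_addr_0 mulr_natl.
Qed.

(** The parameter of cP is c t modulo t^2, so cP = 0 with t nonzero forces t to divide c. This is
    impossible for c odd or c = 2 when 4 divides t. A general multiplier is stripped of its factors
    2 one at a time. *)
Lemma near0_torsionfree (P : point E) n : near0 4%:R (pval P) -> P != 0 -> (0 < n)%N ->
  P *+ n != 0.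
Proof.
have O2 := vr_nat vO 2; have O4 := vr_nat vO 4.
have d24 : dv 2%:R 4%:R by exists 2%:R; rewrite -?natrM.
have key (P' : point E) c : near0 4%:R (pval P') -> P' != 0 -> (c == 2)%N || odd c ->
    P' *+ c != 0.
  move=> {n P} h P0 hc; apply/eqP => e0.
  have [h1 ht] := near0_tpar h; set t := tpar _ in h1 ht.
  have t0 : t != 0.
    apply: contraNneq P0 => e; apply/eqP; apply: val_inj.
    by apply: (near0_tpar_eq0 O4 (valP P') h e).
  have t2 : dv 2%:R t by apply: dv_trans ht.
  have [_] := near0_mulrn c t2 h1; rewrite e0 /= sub0r -/t => -[a Oa ea].
  have [b Ob eb] := ht.
  have e1 : c%:R + t * a = 0.
    apply: (mulIf t0); rewrite mul0r mulrDl.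
    by apply/eqP; rewrite addr_eq0 -[_ * t]opprK ea; apply/eqP; ring.
  case/orP: hc => [/eqP ec|oc].
    have [u0 _] := unit_vr vO (vrM vO Ob Oa); case/eqP: u0.
    apply: (mulfI (two_vr_neq0 vO)); rewrite mulr0 -e1 ec eb; ring.
  have : c%:R + t * a = 1 + 2%:R * (c./2%:R + 2%:R * b * a).
    by rewrite -{1}(odd_double_half c) oc -mul2n natrD natrM /= eb; ring.
  rewrite e1 => e2; have [] := @unit_vr _ _ vO (c./2%:R + 2%:R * b * a).
    apply: (vrD vO); first exact: vr_nat.
    by apply: (vrM vO) => //; apply: (vrM vO).
  by rewrite -e2 eqxx.
elim/ltn_ind: n P => n IH P h P0 n0.
have [on|en] := boolP (odd n); first by apply: key; rewrite ?on ?orbT.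
have -> : n = (2 * n./2)%N by rewrite mul2n -{1}(odd_double_half n) (negbTE en).
rewrite mulrnA; apply: IH.
- by rewrite -divn2 ltn_Pdiv.
- by have [] := near0_mulrn 2 d24 h.
- exact: key.
- by case: n en n0 => [|[|n]].
Qed.

End FormalGroup.

(** * A valuation ring of algC above 2 *)

Section MaximalSubring.
Variables (F : fieldType) (A : F -> Prop).
Hypotheses (A1 : A 1) (AB : forall a b, A a -> A b -> A (a - b))
  (AM : forall a b, A a -> A b -> A (a * b)) (A2 : ~ A 2%:R^-1).

Let A0 : A 0. Proof. by rewrite -(subrr 1); apply: AB. Qed.
Let AN a : A a -> A (- a). Proof. by rewrite -sub0r; apply: AB. Qed.
Let AD a b : A a -> A b -> A (a + b).
Proof. by move=> ha hb; rewrite -[b]opprK; apply: AB => //; apply: AN. Qed.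

(** A witness of degree at most n that 1/2 lies in A[z]. *)
Definition half_poly (z : F) n : Prop := exists a : nat -> F,
  (forall i, A (a i)) /\ 2%:R * (\sum_(i < n.+1) a i * z ^+ i) = 1.

(** The descent in Chevalley's extension theorem. Multiplied by z^(n+1), the relation for 1/z turns
    (1 - 2 b_0) z^(n+1) into twice a polynomial of degree at most n. Multiplying the relation for z
    by 1 - 2 b_0 lets this replace its top term. *)
Lemma half_poly_red z n : z != 0 -> half_poly z n.+1 -> half_poly z^-1 n.+1 -> half_poly z n.
Proof.
move=> z0 [a [ha ea]] [b [hb eb]].
pose c i := (i == 0%N)%:R * b 0%N + (1 - 2%:R * b 0%N) * a i + 2%:R * a n.+1 * b (n.+1 - i)%N.
have A2n : A 2%:R := AD A1 A1.
exists c; split.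
  move=> i; apply: AD; last by apply: AM => //; apply: AM.
  apply: AD; first by apply: AM => //; case: eqP.
  by apply: AM => //; apply: AB => //; apply: AM.
pose p := \sum_(i < n.+1) a i * z ^+ i; pose q := \sum_(i < n.+1) b (n.+1 - i)%N * z ^+ i.
have ep : 2%:R * p = 1 - 2%:R * (a n.+1 * z ^+ n.+1).
  by apply/eqP; rewrite eq_sym subr_eq -mulrDr; move: ea; rewrite big_ord_recr => ->.
have eq : 2%:R * q = (1 - 2%:R * b 0%N) * z ^+ n.+1.
  have -> : q = (\sum_(i < n.+1) b i.+1 * z^-1 ^+ i.+1) * z ^+ n.+1.
    rewrite /q (reindex_inj rev_ord_inj) /= mulr_suml; apply: eq_bigr => i _.
    rewrite subSS; have -> : (n.+1 - (n - i) = i.+1)%N.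
      by rewrite subSn ?leq_subr // subKn // -ltnS.
    rewrite -mulrA; congr (b _ * _).
    have -> : z ^+ n.+1 = z ^+ i.+1 * z ^+ (n - i).
      by rewrite -exprD addSn subnKC // -ltnS.
    by rewrite mulrA -exprMn mulVf // expr1n mul1r.
  rewrite mulrA; congr (_ * _).
  apply/eqP; rewrite eq_sym subr_eq addrC -mulrDr; apply/eqP.
  by move: eb; rewrite big_ord_recl /= expr0 mulr1 => ->.
have -> : \sum_(i < n.+1) c i * z ^+ i = b 0%N + (1 - 2%:R * b 0%N) * p + 2%:R * a n.+1 * q.
  rewrite (eq_bigr (fun i : 'I_n.+1 => (val i == 0%N)%:R * b 0%N * z ^+ i +
    ((1 - 2%:R * b 0%N) * (a i * z ^+ i) + 2%:R * a n.+1 * (b (n.+1 - i)%N * z ^+ i))));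
    last by move=> i _; rewrite /c; ring.
  rewrite !big_split /= -!mulr_sumr -/p -/q addrA; congr (_ + _ + _).
  rewrite big_ord_recl /= expr0 mulr1 mul1r big1 ?addr0 // => i _.
  by rewrite !mul0r.
have -> : 2%:R * (b 0%N + (1 - 2%:R * b 0%N) * p + 2%:R * a n.+1 * q) =
  2%:R * b 0%N + (1 - 2%:R * b 0%N) * (2%:R * p) + 2%:R * a n.+1 * (2%:R * q) by ring.
by rewrite ep eq; ring.
Qed.

Lemma half_poly_contra z n : z != 0 -> half_poly z n -> half_poly z^-1 n -> False.
Proof.
move=> z0; elim: n => [|n IH] h1 h2.
  case: h1 => a [ha]; rewrite big_ord1 expr0 mulr1 => e; apply: A2.
  suff -> : 2%:R^-1 = a 0%N by [].
  have n2 : 2%:R != 0 :> F.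
    by apply: contra_eq_neq e => ->; rewrite mul0r eq_sym oner_neq0.
  by apply: (mulfI n2); rewrite e mulfV.
apply: IH; apply: half_poly_red => //; rewrite ?invr_eq0 // invrK //.
Qed.

Lemma half_poly_le z m n : (m <= n)%N -> half_poly z m -> half_poly z n.
Proof.
move=> h [a [ha ea]]; exists (fun i => if (i <= m)%N then a i else 0); split.
  by move=> i; case: ifP.
rewrite -[X in _ = X]ea; congr (_ * _); rewrite (big_ord_widen n.+1 (fun i => a i * z ^+ i)) ?ltnS //.
rewrite [RHS]big_mkcond /=; apply: eq_bigr => i _.
by rewrite ltnS; case: ifP => // _; rewrite mul0r.
Qed.

End MaximalSubring.

(** A maximal subring without 1/2 is a valuation ring: were z and 1/z both outside, adjoining either
    would produce 1/2, against [half_poly_contra]. *)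
Lemma valring_exists : exists O : algC -> Prop, valring O.
Proof.
(* The element 1 is demanded of nonempty sets only, so that the union of the empty chain
   qualifies. *)
pose P (A : classical_sets.set algC) := [/\ forall a, A a -> A 1, forall a b, A a -> A b -> A (a - b),
   forall a b, A a -> A b -> A (a * b) & ~ A 2%:R^-1].
have half_int : (2%:R^-1 : algC) \notin Num.int.
  apply/negP => /intrP[m hm].
  have : (2 * m)%:~R = 1%:~R :> algC by rewrite intrM -hm mulfV // pnatr_eq0.
  move/intr_inj => /(congr1 (fun z => odd (absz z))).
  by rewrite abszM oddM.
have [|O [[O1 OB OM O2] Omax]] := classical_sets.Zorn_bigcup (P := P).
  move=> C CP Ctot.
  have two X Y a b : C X -> C Y -> X a -> Y b -> exists Z, [/\ C Z, Z a & Z b].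
    move=> CX CY Xa Yb; case: (Ctot X Y CX CY) => h; [exists Y | exists X]; split=> //; exact: h.
  split.
  - by move=> a [X CX Xa]; exists X => //; case: (CP X CX) => h *; apply: h Xa.
  - move=> a b [X CX Xa] [Y CY Yb]; have [Z [CZ Za Zb]] := two X Y a b CX CY Xa Yb.
    by exists Z => //; case: (CP Z CZ) => *; auto.
  - move=> a b [X CX Xa] [Y CY Yb]; have [Z [CZ Za Zb]] := two X Y a b CX CY Xa Yb.
    by exists Z => //; case: (CP Z CZ) => *; auto.
  - by move=> [X CX X2]; case: (CP X CX).
have h1 : O 1.
  (* An empty [O] would lie strictly below the ring of integers, against maximality. *)
  have [[a Oa]|n0] := boolp.pselect (exists a, O a); first exact: O1 Oa.
  exfalso; apply: (Omax (fun x => x \in Num.int)).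
    split; first by move=> a Oa; exfalso; apply: n0; exists a.
    by move=> h; apply: n0; exists 1; apply: h; apply: rpred1.
  split=> [a _|a b|a b|]; [exact: rpred1 | exact: rpredB | exact: rpredM | exact/negP].
exists O; split=> //.
have O0 : O 0 by rewrite -(subrr 1); apply: OB.
have ON a : O a -> O (- a) by rewrite -sub0r; apply: OB.
have OD a b : O a -> O b -> O (a + b).
  by move=> ha hb; rewrite -[b]opprK; apply: OB => //; apply: ON.
have hz z : ~ O z -> exists n, half_poly O z n.
  move=> nz; pose B : classical_sets.set algC := fun x => exists2 p : {poly algC}, (forall i, O p`_i) & x = p.[z].
  have [[p hp e]|nB] := boolp.pselect (B 2%:R^-1).
    exists (size p), (fun i => p`_i); split=> //.
    by rewrite -horner_coef_wide // -e mulfV // pnatr_eq0.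
  exfalso; apply: (Omax B).
    split; last first.
      move=> h; apply: nz; apply: h; exists 'X; last by rewrite hornerX.
      by move=> i; rewrite coefX; case: eqP.
    move=> a Oa; exists a%:P; last by rewrite hornerC.
    by move=> i; rewrite coefC; case: eqP.
  split=> //.
  - by move=> a _; exists 1; [move=> i; rewrite coef1; case: eqP | rewrite hornerE].
  - move=> a b [p hp ->] [q hq ->]; exists (p - q); last by rewrite hornerD hornerN.
    by move=> i; rewrite coefB; apply: OB.
  - move=> a b [p hp ->] [q hq ->]; exists (p * q); last by rewrite hornerM.
    by move=> i; rewrite coefM; apply: big_ind => // j _; apply: OM.
move=> z; have [->|z0] := eqVneq z 0; first by left.
have [h|nz] := boolp.pselect (O z); first by left.
have [h|nz'] := boolp.pselect (O z^-1); first by right.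
exfalso; have [n hn] := hz z nz; have [m hm] := hz _ nz'.
apply: (@half_poly_contra _ O h1 OB OM O2 z (maxn n m)) => //.
  by apply: half_poly_le hn; rewrite // leq_maxl.
by apply: half_poly_le hm; rewrite // leq_maxr.
Qed.

Section AlgValuation.
Variable O : algC -> Prop.
Hypothesis vO : valring O.
Local Notation dv := (dv O).

Lemma integral_vr (p : {poly algC}) x : p \is monic -> (forall i, O p`_i) -> root p x -> O x.
Proof.
move=> mp hp rp; case: (vrV vO x) => // hx.
have [->|x0] := eqVneq x 0; first exact: (vr0 vO).
have [n sp] : exists n, size p = n.+1.
  by exists (size p).-1; rewrite prednK // size_poly_gt0 monic_neq0.
have lp : p`_n = 1 by move/eqP: mp; rewrite lead_coefE sp.
move: rp; rewrite /root horner_coef sp big_ord_recr /= lp mul1r addr_eq0 => /eqP e.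
case: n sp lp e => [|n] sp lp e.
  by move/eqP: e; rewrite big_ord0 eq_sym oppr_eq0 oner_eq0.
have -> : x = - \sum_(i < n.+1) p`_i * x^-1 ^+ (n - i).
  apply: (mulIf (expf_neq0 n x0)); rewrite -exprS -[LHS]opprK -e mulNr; congr (- _).
  rewrite mulr_suml; apply: eq_bigr => i _; rewrite -mulrA; congr (_ * _).
  have -> : x ^+ n = x ^+ (n - i) * x ^+ i by rewrite -exprD subnK // -ltnS.
  by rewrite mulrA -exprMn mulVf // expr1n mul1r.
apply: (vrN vO); apply: (vr_sum vO) => i.
by apply: (vrM vO) => //; apply: (vrX vO).
Qed.

Lemma vr_int (z : int) : O z%:~R.
Proof.
by case: z => n; rewrite ?NegzE ?mulrNz; [|apply: (vrN vO)]; apply: (vr_nat vO).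
Qed.

Lemma Aint_vr x : x \in Aint -> O x.
Proof.
move=> h; apply: (@integral_vr (minCpoly x)); rewrite ?minCpoly_monic ?root_minCpoly //.
by move=> i; have /intrP[z ->] := polyOverP h i; apply: vr_int.
Qed.

Lemma rat_denom (q : rat) : exists k, O (2%:R ^+ k * ratr q).
Proof.
have dgt : (0 < `|denq q|)%N by rewrite absz_gt0 denq_neq0.
exists (logn 2 `|denq q|).
rewrite /ratr -[denq q]gez0_abs ?denq_ge0 //.
rewrite -{2}(partnC 2%N dgt) p_part PoszM intrM invfM.
have odd_d : odd (`|denq q|%N)`_(2%N^').
  by rewrite -coprime2n -[2%N]/(2 ^ 1)%N; apply: (pnat_coprime (pi := 2%N)); [|apply: part_pnat].
have [o0 oV] := vr_odd vO odd_d.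
have e2 : (Posz (2 ^ logn 2 `|denq q|))%:~R = 2%:R ^+ logn 2 `|denq q| :> algC.
  by rewrite -natrX.
rewrite e2 mulrCA; set P2 := (2%:R ^+ _); have p0 : P2 != 0 by rewrite expf_neq0 // pnatr_eq0.
rewrite mulVKf //; apply: (vrM vO); [exact: vr_int | exact: oV].
Qed.

(** Let c = 2^k clear the coefficients p_i of the minimal polynomial of x; then c x is a root of the
    monic polynomial with coefficients c^(n-i) p_i in [O]. This makes the valuation archimedean: no
    nonzero number is divisible by all powers of 2. *)
Lemma exp2_denom x : exists k, O (2%:R ^+ k * x).
Proof.
have [p [ep mp] _] := minCpolyP x.
have [k hk] : exists k, forall i : 'I_(size p), O (2%:R ^+ k * ratr p`_i).
  elim: (size p) => [|n [k hk]]; first by exists 0%N => -[].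
  have [j hj] := rat_denom p`_n.
  exists (k + j)%N => i; have [lt|ge] := ltnP i n.
    rewrite exprD [_ * 2%:R ^+ j]mulrC -mulrA; apply: (vrM vO); first exact/(vrX vO)/(vr_nat vO).
    exact: (hk (Ordinal lt)).
  have -> : nat_of_ord i = n by apply/eqP; rewrite eqn_leq ge -ltnS ltn_ord.
  rewrite exprD -mulrA; apply: (vrM vO) => //; exact/(vrX vO)/(vr_nat vO).
exists k; set c := 2%:R ^+ k; have c0 : c != 0 by rewrite expf_neq0 // pnatr_eq0.
have Oc : O c by exact/(vrX vO)/(vr_nat vO).
have [n sp] : exists n, size p = n.+1.
  by exists (size p).-1; rewrite prednK // size_poly_gt0 monic_neq0.
pose q : {poly algC} := \poly_(i < n.+1) (c ^+ (n - i) * ratr p`_i).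
have lp : p`_n = 1 by move/eqP: mp; rewrite lead_coefE sp.
have qn : q`_n = 1 by rewrite coef_poly ltnSn subnn expr0 mul1r lp rmorph1.
apply: (@integral_vr q).
- have sq : size q = n.+1.
    by apply: size_poly_eq; rewrite subnn expr0 mul1r lp rmorph1 oner_neq0.
  by rewrite monicE lead_coefE sq qn.
- move=> i; rewrite coef_poly; case: ltnP => // [lt|_]; last exact: (vr0 vO).
  have [e|ni] := eqVneq i n; first by rewrite e subnn lp rmorph1 mulr1; apply: (vr1 vO).
  have lt' : (i < n)%N by rewrite ltn_neqAle ni -ltnS.
  rewrite -(subnSK lt') exprSr -mulrA; apply: (vrM vO); first exact: (vrX vO).
  have lts : (i < size p)%N by rewrite sp.
  exact: (hk (Ordinal lts)).
have := root_minCpoly x; rewrite ep /root horner_coef size_map_poly sp => /eqP e.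
apply/eqP; rewrite (@horner_coef_wide _ n.+1) ?size_poly //.
transitivity (c ^+ n * \sum_(i < n.+1) (map_poly ratr p)`_i * x ^+ i); last by rewrite e mulr0.
rewrite mulr_sumr; apply: eq_bigr => i _; rewrite coef_poly ltn_ord coef_map /= exprMn.
have -> : c ^+ n = c ^+ (n - i) * c ^+ i by rewrite -exprD subnK // -ltnS.
by ring.
Qed.

End AlgValuation.

(** * Gallai's theorem *)

Section Gallai.
Variables (V : zmodType) (S : V -> Prop).
Hypothesis SD : forall a b, S a -> S b -> S (a + b).
Hypothesis S0 : S 0.

Let SM a n : S a -> S (a *+ n).
Proof. by move=> h; elim: n => [|n IH]; rewrite ?mulr0n // mulrS; apply: SD. Qed.

Definition monochromatic (C : finType) (L : seq V) (c : V -> C) (xz : V * nat) : Prop :=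
  {in L &, forall l l', c (xz.1 + l *+ xz.2) = c (xz.1 + l' *+ xz.2)}.

(** One finite list [W] serves all colourings. The induction colours a vector by the restriction of
    [c] to a finite set of its translates, and needs finiteness for this to be again a finite
    colouring. *)
Definition gallai (L : seq V) : Prop := forall C : finType, exists W : seq (V * nat),
  (forall xz, xz \in W -> S xz.1 /\ (0 < xz.2)%N) /\
  forall c : V -> C, exists2 xz, xz \in W & monochromatic L c xz.

(* Colour focusing: either a monochromatic copy of mu :: L is already present, or
   s copies of L of pairwise distinct colours are focused on a common point a. *)
Lemma focusing (mu : V) (L : seq V) (C : finType) : L != [::] ->
  (forall l, l \in mu :: L -> S l) -> gallai L ->
  forall s, exists (W : seq (V * nat)) (B : seq V),
  (forall xz, xz \in W -> S xz.1 /\ (0 < xz.2)%N) /\ (forall b, b \in B -> S b) /\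
  forall c : V -> C, (exists2 xz, xz \in W & monochromatic (mu :: L) c xz) \/
    exists (a : V) (D : seq (nat * C)), [/\ a \in B, size D = s, uniq (unzip2 D) &
     forall zk, zk \in D -> (a - mu *+ zk.1, zk.1) \in W /\
       forall l, l \in L -> a + (l - mu) *+ zk.1 \in B /\ c (a + (l - mu) *+ zk.1) = zk.2].
Proof.
move=> L0 SL gL; elim=> [|s [W [B [hW [hB IH]]]]].
  exists [::], [:: 0]; split=> //; split; first by move=> b; rewrite inE => /eqP ->.
  by move=> c; right; exists 0, [::]; split=> //; rewrite mem_head.
have [l0 l0L] : exists l, l \in L by case: L L0 {SL gL IH} => // l L _; exists l; rewrite mem_head.
(* In a copy v + L z that is monochromatic for this product colouring, the colour of v + l z + b
   does not depend on l, for all b in [B] at once. *)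
have [W' [hW' gW']] := gL {ffun 'I_(size B) -> C}.
pose pts := [seq vz.1 + l *+ vz.2 | vz <- W', l <- mu :: L].
pose B2 := [seq p + b | p <- pts, b <- B].
(* [W2a] translates the earlier copies, [W2b] adds the new dilation to those of the focused
   families, and [W2c] holds the new family; the new focus is v + mu z + a. *)
pose W2a := [seq (vz.1 + l0 *+ vz.2 + xz.1, xz.2) | vz <- W', xz <- W].
pose W2b := [seq (vz.1 + xz.1, (xz.2 + vz.2)%N) | vz <- W', xz <- W].
pose W2c := [seq (vz.1 + b, vz.2) | vz <- W', b <- B].
exists (W2a ++ W2b ++ W2c), B2; split; last split.
- move=> xz; rewrite !mem_cat => /or3P[] /allpairsP[[vz w] /= [h1 h2 ->]] /=;
    have [Sv z0] := hW' _ h1.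
  + have [Sx x0] := hW _ h2; split=> //; apply: SD => //; apply: SD => //.
    by apply: SM; apply: SL; rewrite inE l0L orbT.
  + by have [Sx x0] := hW _ h2; rewrite addn_gt0 x0; split=> //; apply: SD.
  + by split=> //; apply: SD => //; apply: hB.
- move=> b' /allpairsP[[p b] /= [/allpairsP[[vz l] /= [h1 h2 ->]] hb ->]].
  have [Sv _] := hW' _ h1; apply: SD; last exact: hB.
  by apply: SD => //; apply: SM; apply: SL.
move=> c; pose c' v : {ffun 'I_(size B) -> C} := [ffun i : 'I_(size B) => c (v + B`_i)].
have [[v z] hvz hmono] := gW' c'; rewrite /monochromatic /= in hmono.
pose c0 b := c (v + l0 *+ z + b).
have c0E l b : l \in L -> b \in B -> c (v + l *+ z + b) = c0 b.
  move=> lL bB; have ltb : (index b B < size B)%N by rewrite index_mem.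
  have /ffunP/(_ (Ordinal ltb)) := hmono l l0 lL l0L.
  by rewrite !ffunE /= nth_index.
have left_case : (exists2 xz, xz \in W & monochromatic (mu :: L) c0 xz) ->
    exists2 xz, xz \in W2a ++ W2b ++ W2c & monochromatic (mu :: L) c xz.
  case=> [[x z1] hx hm]; exists (v + l0 *+ z + x, z1).
    by rewrite mem_cat; apply/orP; left; apply/allpairsP; exists ((v, z), (x, z1)).
  by move=> l l' hl hl'; have := hm l l' hl hl'; rewrite /c0 /= !addrA.
case: (IH c0) => [h|[a [D [aB sD uD hD]]]]; first by left; apply: left_case.
have inpts l : l \in mu :: L -> v + l *+ z \in pts.
  by move=> hl; apply/allpairsP; exists ((v, z), l).
(* If the colour of the focus [a] occurs among the families, that family and [a] form a
   monochromatic copy of [mu :: L]. Otherwise it is the colour of the new family. *)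
have [/mapP[[z1 k] zD /= ek]|nin] := boolP (c0 a \in unzip2 D).
  left; apply: left_case; have [hin hl] := hD _ zD; exists (a - mu *+ z1, z1) => //.
  have al l : l \in mu :: L -> c0 (a - mu *+ z1 + l *+ z1) = c0 a.
    rewrite inE => /orP[/eqP ->|lL]; first by rewrite subrK.
    have [_ e] := hl l lL; rewrite /= in e.
    have -> : a - mu *+ z1 + l *+ z1 = a + (l - mu) *+ z1.
      by rewrite mulrnBl addrAC addrA.
    by rewrite e ek.
  by move=> l l' hl1 hl2; rewrite /= !al.
right; exists (v + mu *+ z + a), ((z, c0 a) :: [seq ((zk.1 + z)%N, zk.2) | zk <- D]).
split.
- by apply/allpairsP; exists (v + mu *+ z, a); split=> //; apply: inpts; rewrite mem_head.
- by rewrite /= size_map sD.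
- by rewrite /= /unzip2 -map_comp nin.
move=> zk; rewrite inE => /orP[/eqP -> /=|/mapP[[z1 k] zD -> /=]].
  split.
    rewrite !mem_cat; apply/or3P; apply: Or33; apply/allpairsP; exists ((v, z), a); split=> //=.
    by rewrite addrAC addrK.
  move=> l lL; have -> : v + mu *+ z + a + (l - mu) *+ z = v + l *+ z + a.
    rewrite mulrnBl -!addrA; congr (v + _); rewrite [mu *+ z + _]addrC -!addrA addNr addr0.
    by rewrite addrC.
  split; last exact: c0E.
  by apply/allpairsP; exists (v + l *+ z, a); split=> //; apply: inpts; rewrite inE lL orbT.
have [hin hl] := hD _ zD; split.
  rewrite !mem_cat; apply/or3P; apply: Or32; apply/allpairsP.
  exists ((v, z), (a - mu *+ z1, z1)); split=> //=; congr (_, _).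
  by rewrite [v + _ + a]addrAC mulrnDr opprD [- _ - _]addrC !addrA addrK.
move=> l lL; have [h1 h2] := hl l lL; rewrite /= in h1 h2.
have -> : v + mu *+ z + a + (l - mu) *+ (z1 + z) = v + l *+ z + (a + (l - mu) *+ z1).
  rewrite mulrnDr -!addrA; congr (v + _); rewrite [in LHS]addrCA; rewrite [in RHS]addrCA; congr (a + _).
  rewrite addrCA [in RHS]addrC; congr (_ + _).
  by rewrite mulrnBl addrC subrK.
split; last by rewrite c0E.
by apply/allpairsP; exists (v + l *+ z, a + (l - mu) *+ z1); split=> //; apply: inpts; rewrite inE lL orbT.
Qed.

Lemma gallai_theorem (L : seq V) : (forall l, l \in L -> S l) -> gallai L.
Proof.
elim: L => [|mu L IH] SL C.
  exists [:: (0, 1%N)]; split; first by move=> xz; rewrite inE => /eqP ->.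
  by move=> c; exists (0, 1%N); rewrite ?mem_head.
have [->|L0] := eqVneq L [::].
  exists [:: (0, 1%N)]; split; first by move=> xz; rewrite inE => /eqP ->.
  move=> c; exists (0, 1%N); rewrite ?mem_head // => l l'.
  by rewrite !inE => /eqP -> /eqP ->.
have gL : gallai L by apply: IH => l lL; apply: SL; rewrite inE lL orbT.
have [W [B [hW [_ h]]]] := @focusing mu L C L0 SL gL #|C|.+1.
exists W; split=> // c; case: (h c) => // -[a [D [_ sD uD _]]].
(* There are not enough colours for [#|C|.+1] families of distinct colours. *)
have := max_card [in unzip2 D]; rewrite (card_uniqP uD) size_map sD.
by rewrite ltnn.
Qed.

End Gallai.

(** * Automorphism groups of algC and square classes *)

Lemma galQ_rmorph f : galQ f -> exists nu : {rmorphism algC -> algC}, (nu : algC -> algC) = f.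
Proof.
move=> [fD [fM [f1 _]]].
have f0 : f 0 = 0 by apply: (addrI (f 0)); rewrite -fD !addr0.
have fa : zmod_morphism f.
  by move=> x y; apply/eqP; rewrite eq_sym subr_eq -fD subrK.
have fm : monoid_morphism f by [].
pose faM := GRing.isZmodMorphism.Build _ _ f fa.
pose fmM := GRing.isMonoidMorphism.Build _ _ f fm.
pose fRM : {rmorphism _ -> _} := HB.pack f faM fmM.
by exists fRM.
Qed.

Lemma rmorph_galQ (nu : {rmorphism algC -> algC}) : galQ nu.
Proof.
split; first exact: rmorphD; split; first exact: rmorphM; split; first exact: rmorph1.
by exists (algC_invaut nu); [apply: algC_autK | apply: algC_invautK].
Qed.

Lemma galQ_id : galQ id.
Proof. by do !split=> //; exists id. Qed.

Lemma galQ_comp f g : galQ f -> galQ g -> galQ (f \o g).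
Proof.
move=> [fD [fM [f1 fB]]] [gD [gM [g1 gB]]]; split; first by move=> x y; rewrite /= gD fD.
split; first by move=> x y; rewrite /= gM fM.
by split; [rewrite /= g1 f1 | apply: bij_comp].
Qed.

Lemma galQ_inv f : galQ f -> exists g, [/\ galQ g, cancel f g & cancel g f].
Proof.
move=> [fD [fM [f1 [g fK gK]]]]; exists g; split=> //.
split; first by move=> x y; apply: (can_inj fK); rewrite fD !gK.
split; first by move=> x y; apply: (can_inj fK); rewrite fM !gK.
by split; [rewrite -f1 fK | exists f].
Qed.

Record autgroup (G : (algC -> algC) -> Prop) : Prop := {
  ag_gal : forall f, G f -> galQ f;
  ag_id : G id;
  ag_comp : forall f g, G f -> G g -> G (f \o g);
  ag_inv : forall f, G f -> exists g, [/\ G g, cancel f g & cancel g f] }.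

Lemma closed_autgroup G : closed_subgroup G -> autgroup G.
Proof.
move=> [h1 [h2 [h3 [h4 _]]]]; split=> // f Gf.
have [g [Gg fK gK]] := galQ_inv (h1 f Gf).
by exists g; split=> //; apply: h4 Gf Gg fK.
Qed.

Lemma galQ_autgroup : autgroup galQ.
Proof. by split=> //; [apply: galQ_id | apply: galQ_comp | apply: galQ_inv]. Qed.

(** For closed G with fixed field F, this is the field F(vs) by Galois theory; described through
    invariants, it requires no construction of an extension. With [galQ] for G it is the number
    field Q(vs). *)
Definition fix_stab (G : (algC -> algC) -> Prop) (vs : seq algC) (x : algC) : Prop :=
  forall f, G f -> (forall v, v \in vs -> f v = v) -> f x = x.

Section Reps.
Variables (G : (algC -> algC) -> Prop) (vs : seq algC).
Hypotheses (aG : autgroup G) (sG : forall f v, G f -> v \in vs -> f v \in vs).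

Lemma agree_fix_stab f g x : G f -> G g -> agree_on vs f g -> fix_stab G vs x -> f x = g x.
Proof.
move=> Gf Gg a hx; have [g' [Gg' gK g'K]] := ag_inv aG Gg.
apply: (can_inj g'K); rewrite gK; apply: (hx (g' \o f)); first exact: ag_comp.
by move=> v hv; rewrite /= a.
Qed.

(** The [h i] represent the embeddings of F(vs) over F. As G preserves [vs], each is recorded by a
    map between indices. *)
Lemma agree_classes_finite : exists (I : finType) (h : I -> algC -> algC),
  [/\ forall i, G (h i), forall f, G f -> exists i, agree_on vs f (h i) &
      forall i j, agree_on vs (h i) (h j) -> i = j].
Proof.
pose k := size vs.
pose pat (f : algC -> algC) : {ffun 'I_k -> 'I_k.+1} :=
  [ffun i : 'I_k => inord (index (f vs`_i) vs)].
have patE f g : G f -> G g -> (pat f = pat g <-> agree_on vs f g).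
  move=> Gf Gg; split=> [e v hv|a]; last first.
    by apply/ffunP => i; rewrite !ffunE a // mem_nth.
  have lv : (index v vs < k)%N by rewrite index_mem.
  have /(congr1 val) := congr1 (fun p : {ffun 'I_k -> 'I_k.+1} => p (Ordinal lv)) e.
  rewrite !ffunE /= nth_index // !inordK ?ltnS ?index_size // => ei.
  by rewrite -[LHS](nth_index 0 (sG Gf hv)) ei nth_index // sG.
pose att p := boolp.asbool (exists2 f, G f & pat f = p).
pose I : finType := {p : {ffun 'I_k -> 'I_k.+1} | att p}.
have ex (i : I) : exists f, G f /\ pat f = val i.
  by have /boolp.asboolP[f Gf e] := valP i; exists f.
have [h hh] := boolp.choice ex.
exists I, h; split.
- by move=> i; case: (hh i).
- move=> f Gf; have ap : att (pat f) by apply/boolp.asboolP; exists f.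
  exists (Sub (pat f) ap); have [Gh e] := hh (Sub (pat f) ap).
  by apply/patE => //; rewrite e.
- move=> i j a; have [Gi ei] := hh i; have [Gj ej] := hh j.
  by apply: val_inj; rewrite -ei -ej; apply/patE.
Qed.

Lemma fix_stabD x y : fix_stab G vs x -> fix_stab G vs y -> fix_stab G vs (x + y).
Proof. by move=> hx hy f Gf hf; have [fD _] := ag_gal aG Gf; rewrite fD (hx f) ?(hy f). Qed.
Lemma fix_stabM x y : fix_stab G vs x -> fix_stab G vs y -> fix_stab G vs (x * y).
Proof. by move=> hx hy f Gf hf; have [_ [fM _]] := ag_gal aG Gf; rewrite fM (hx f) ?(hy f). Qed.
Lemma fix_stab_rat x : x \in Crat -> fix_stab G vs x.
Proof.
by move=> hx f Gf _; have [nu <-] := galQ_rmorph (ag_gal aG Gf); apply: aut_Crat.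
Qed.
Lemma fix_stab_nat n : fix_stab G vs n%:R.
Proof. by apply: fix_stab_rat; apply: rpred_nat. Qed.
Lemma fix_stabN x : fix_stab G vs x -> fix_stab G vs (- x).
Proof.
move=> hx; rewrite -mulN1r; apply: fix_stabM => //; apply: fix_stab_rat.
by rewrite rpredN rpred1.
Qed.
Lemma fix_stabV x : fix_stab G vs x -> fix_stab G vs x^-1.
Proof.
move=> hx f Gf hf; have := hx f Gf hf; have [nu <-] := galQ_rmorph (ag_gal aG Gf).
by rewrite fmorphV => ->.
Qed.
Lemma fix_stabX x n : fix_stab G vs x -> fix_stab G vs (x ^+ n).
Proof.
move=> hx; elim: n => [|n IH]; last by rewrite exprS; apply: fix_stabM.
by rewrite expr0; apply: (fix_stab_nat 1).
Qed.
Lemma fix_stab_sum (J : Type) (r : seq J) (P : pred J) (f : J -> algC) :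
  (forall i, P i -> fix_stab G vs (f i)) -> fix_stab G vs (\sum_(i <- r | P i) f i).
Proof.
by move=> h; apply: big_ind => //; [apply: (fix_stab_nat 0) | apply: fix_stabD].
Qed.
Lemma fix_stab_in v : v \in vs -> fix_stab G vs v.
Proof. by move=> hv f _; apply. Qed.

Hypothesis tfG : top_fin_gen G.

(* The colour of x records, for each topological generator, the signs by which it
   permutes the square roots of the conjugates of x. *)
Lemma square_class_coloring : exists (C : finType) (col : algC -> C),
  forall x x', fix_stab G vs x -> fix_stab G vs x' -> x != 0 -> x' != 0 ->
  col x = col x' -> exists2 r, fix_stab G vs r & r ^+ 2 = x * x'.
Proof.
have [gs [gsG dense]] := tfG.
have [I [h [hG hex huniq]]] := agree_classes_finite.
pose g0 (j : 'I_(size gs)) : algC -> algC := nth id gs j.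
have g0G j : G (g0 j).
  by apply: gsG; rewrite /g0; elim: (gs) j => [[]//|g l IH] [[|j] hj] /=; [left | right; apply: (IH (Ordinal (hj : (j < size l)%N)))].
pose rt x i := sqrtC (h i x).
pose col x : {ffun 'I_(size gs) * I * I -> bool} :=
  [ffun p => g0 p.1.1 (rt x p.1.2) == rt x p.2].
exists {ffun 'I_(size gs) * I * I -> bool}, col => x x' hx hx' x0 x'0 ecol.
(* The generators of G need not fix [vs], so a square root of x x' is followed through all
   conjugates. Equal colours mean that the signs picked up by the two factors cancel. *)
pose rho i := rt x i * rt x' i.
pose good f := forall i j, agree_on vs (f \o h i) (h j) -> f (rho i) = rho j.
have rt2 y i : rt y i ^+ 2 = h i y by rewrite sqrtCK.
have fsq f y i j : G f -> fix_stab G vs y -> agree_on vs (f \o h i) (h j) ->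
    f (rt y i) = rt y j \/ f (rt y i) = - rt y j.
  move=> Gf hy a; have e : f (rt y i) ^+ 2 = rt y j ^+ 2.
    have [nu enu] := galQ_rmorph (ag_gal aG Gf).
    rewrite rt2 -(agree_fix_stab (ag_comp aG Gf (hG i)) (hG j) a hy) /= -enu.
    by rewrite -rmorphXn rt2.
  by move/eqP: e; rewrite eqf_sqr => /orP[] /eqP; [left | right].
have rt0 y i : y != 0 -> rt y i != 0.
  have [nu enu] := galQ_rmorph (ag_gal aG (hG i)).
  by move=> y0; rewrite /rt sqrtC_eq0 -enu fmorph_eq0.
have neq y i : y != 0 -> (- rt y i == rt y i) = false.
  by move=> /(rt0 _ i) y0; rewrite eq_sym -addr_eq0 -mulr2n mulrn_eq0 (negbTE y0).
have good_gen j : good (g0 j).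
  move=> i k a; have [_ [fM _]] := ag_gal aG (g0G j); rewrite /rho fM.
  have /ffunP/(_ (j, i, k)) := ecol; rewrite !ffunE /=.
  case: (fsq _ x i k (g0G j) hx a) => ->; case: (fsq _ x' i k (g0G j) hx' a) => -> //;
    rewrite ?eqxx ?neq // mulrNN //.
have gen_good f : gen_by gs f -> G f /\ good f.
  elim=> {f} [|f inf|f g _ [Gf gf] _ [Gg gg]|f g _ [Gf gf] gK fK].
  - by split; [apply: ag_id | move=> i j a; rewrite (huniq i j)].
  - have [j ->] : exists j, f = g0 j.
      elim: (gs) inf @g0 {g0G col ecol good_gen} => [//|g l IH] /= [->|inl].
        by exists (Ordinal (isT : (0 < (size l).+1)%N)).
      by have [j ->] := IH inl; exists (Ordinal (ltn_ord j : (j.+1 < (size l).+1)%N)).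
    by split.
  - split; first exact: ag_comp.
    move=> i k a; have [j aj] := hex _ (ag_comp aG Gg (hG i)).
    rewrite /= (gg i j) //; apply: gf => v hv /=.
    by have := a v hv; rewrite /= -(aj v hv).
  - have Gg : G g.
      have [g' [Gg' f1 f2]] := ag_inv aG Gf.
      suff -> : g = g' by [].
      by apply: boolp.funext => y; rewrite -[y in LHS]f2 gK.
    split=> // i j a; apply: (can_inj gK); rewrite fK; apply/esym; apply: gf => v hv /=.
    by rewrite -(a v hv) /= fK.
have all_good f : G f -> good f.
  move=> Gf i j a.
  have [h' [gen ag]] := dense f Gf (rho i :: [seq h i v | v <- vs]).
  rewrite ag ?mem_head //; have [_ gd] := gen_good _ gen; apply: gd => v hv /=.
  by rewrite -ag ?inE ?map_f ?orbT //; apply: a.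
have [i0 a0] := hex id (ag_id aG).
exists (rho i0).
  move=> f Gf hf; apply: all_good => // v hv /=.
  by rewrite -a0 // hf.
rewrite /rho exprMn !rt2.
by rewrite -!(agree_fix_stab (ag_id aG) (hG i0) a0).
Qed.

End Reps.

Lemma sqrt_conj (s : algC) : s ^+ 2 \in Crat -> s \notin Crat ->
  exists nu : {rmorphism algC -> algC}, nu s = - s.
Proof.
move=> /CratP[a ea] ns.
have [Qn [QnC [[|zn []] // [Dz]]] genQn] := num_field_exists [:: s].
pose phi := kHomExtend 1 \1 zn (- zn).
have homQn1: kHom 1 1 (\1%VF : 'End(Qn)) by rewrite kHom1.
have nz : zn \notin 1%VS.
  apply: contra ns => /vlineP[b eb]; rewrite -Dz eb alg_num_field fmorph_rat.
  by apply/CratP; exists b.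
have z2 : zn ^+ 2 \in 1%VS.
  have -> : zn ^+ 2 = a%:A.
    by apply: (fmorph_inj QnC); rewrite rmorphXn /= Dz ea alg_num_field fmorph_rat.
  by rewrite rpredZ // rpred1.
have rt : root (minPoly 1 zn) (- zn).
  pose q : {poly Qn} := 'X^2 - (zn ^+ 2)%:P.
  have qO : q \is a polyOver 1%VS by rewrite rpredB ?polyOverXn ?polyOverC.
  have rq y : root q y = (y ^+ 2 == zn ^+ 2).
    by rewrite /root !hornerE subr_eq0.
  have dvq : (minPoly 1 zn %| q)%R by apply: minPoly_dvdp; rewrite // rq.
  have sq : size q = 3%N by rewrite size_XnsubC.
  have q0 : q != 0 by rewrite -size_poly_eq0 sq.
  have := dvdp_leq q0 dvq; rewrite sq size_minPoly ltnS => le2.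
  have ne1 : adjoin_degree 1 zn != 1%N by rewrite [_ == _]adjoin_deg_eq1.
  have e2 : adjoin_degree 1 zn = 2%N.
    by move: ne1 le2; rewrite /adjoin_degree; case: (_.-1) => [|[|[|?]]].
  have : minPoly 1 zn %= q by rewrite -(dvdp_size_eqp dvq) sq size_minPoly e2.
  by move/eqp_root => ->; rewrite rq sqrrN.
have pz : root (map_poly \1%VF (minPoly 1 zn)) (- zn).
  by rewrite map_polyE map_id_in => [|?]; rewrite ?id_lfunE // polyseqK.
have phim : monoid_morphism phi.
  by apply/kHom_monoid_morphism; rewrite -genQn span_seq1 /= kHomExtendP.
pose phimM := GRing.isMonoidMorphism.Build _ _ phi phim.
pose phiRM : {rmorphism _ -> _} := HB.pack (fun_of_lfun phi) phimM.
have [nu Dnu] := extend_algC_subfield_aut QnC phiRM.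
exists nu; rewrite -Dz -Dnu /= /phi (kHomExtend_val homQn1 pz).
by rewrite rmorphN.
Qed.

Lemma conjugates_closure (Z : seq algC) : exists vs : seq algC,
  [/\ {subset Z <= vs}, forall f v, galQ f -> v \in vs -> f v \in vs &
      {subset Z <= Aint} -> {subset vs <= Aint}].
Proof.
have ex z : exists r : seq algC, forall x, (x \in r) = root (minCpoly z) x.
  have [r er] := closed_field_poly_normal (minCpoly z).
  exists r => x; rewrite er rootZ ?lead_coef_eq0 ?minCpoly_eq0 //.
  by rewrite root_prod_XsubC.
have [rs hrs] := boolp.choice ex.
exists (flatten [seq rs z | z <- Z]); split.
- by move=> z hz; apply/flatten_mapP; exists z; rewrite // hrs root_minCpoly.
- move=> f v gf /flatten_mapP[z hz]; rewrite hrs => rv; apply/flatten_mapP; exists z => //.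
  have [nu <-] := galQ_rmorph gf; rewrite hrs.
  have [p [ep _] _] := minCpolyP z.
  have -> : minCpoly z = map_poly nu (minCpoly z).
    by rewrite ep -map_poly_comp; apply: eq_map_poly => a /=; rewrite fmorph_rat.
  by rewrite fmorph_root.
move=> ZA v /flatten_mapP[z hz]; rewrite hrs => rv.
by apply: (root_monic_Aint rv (minCpoly_monic z)); apply: ZA.
Qed.

Lemma prime_seq : exists pr : nat -> nat, (forall i, prime (pr i)) /\ injective pr.
Proof.
pose pr := fix pr n := if n is m.+1 then s2val (prime_above (pr m)) else 2%N.
exists pr; split; first by case=> //= n; case: prime_above.
have inc i : (pr i < pr i.+1)%N by rewrite /=; case: prime_above.
have mono := homo_ltn ltn_trans inc.
move=> i j e; case: (ltngtP i j) => // lt; have := mono _ _ lt; by rewrite e ltnn.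
Qed.

(** The exponent of p in p q r^2 is odd, even when r = p. *)
Lemma sqrt_primes_irrat (p q r : nat) (s : algC) : prime p -> prime q -> prime r -> p != q ->
  s ^+ 2 = (p * q * r ^ 2)%:R -> s \notin Crat.
Proof.
move=> pp pq pr npq e; apply/negP => /CratP[a ea].
set n := (p * q * r ^ 2)%N in e.
have n0 : (0 < n)%N by rewrite !muln_gt0 ?expn_gt0 !prime_gt0.
have e1 : a ^+ 2 = n%:R.
  by apply: (fmorph_inj (ratr : rat -> algC)); rewrite rmorphXn /= -ea e rmorph_nat.
have d0 : (denq a)%:~R != 0 :> rat by rewrite intr_eq0 denq_neq0.
have e2 : ((numq a) ^+ 2 = n%:Z * (denq a) ^+ 2).
  apply: (@intr_inj rat); rewrite rmorphXn rmorphM rmorphXn /=.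
  rewrite -[n%:Z%:~R]/(n%:R) -e1 -{2}(divq_num_den a) expr_div_n divfK //.
  by rewrite expf_neq0.
have /(congr1 (fun k => odd (logn p k))) : (`|numq a| ^ 2 = n * `|denq a| ^ 2)%N.
  by have := congr1 absz e2; rewrite abszM !abszX.
have dg : (0 < `|denq a| ^ 2)%N by rewrite expn_gt0 absz_gt0 denq_neq0.
rewrite lognX lognM // lognX oddM oddD oddM /= addbF.
rewrite /n lognM ?muln_gt0 ?expn_gt0 ?prime_gt0 // lognM ?prime_gt0 // lognX.
by rewrite !logn_prime // eqxx (negbTE npq) oddD oddM.
Qed.

Lemma fix_stab_nil G x : fix_stab G [::] x <-> fixed_field G x.
Proof. by split=> h f Gf; [apply: h | move=> _; apply: h]. Qed.

(** Otherwise the algebraic integers of F all lie in the number field Q(vs). But F has finitely many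
    square classes, so each prime p_i has a square root [d i] of its product with one of finitely
    many representatives in F, and these are too many for a number field. *)
Lemma moving_automorphism_exists G (Z : seq algC) : closed_subgroup G -> top_fin_gen G ->
  exists (nu : {rmorphism algC -> algC}) (d : algC),
  [/\ forall z, z \in Z -> nu z = z, fixed_field G d, d \in Aint & nu d <> d].
Proof.
move=> cG tG; have aG := closed_autgroup cG.
apply: boolp.contrapT => none.
have [vs [Zvs vsG _]] := conjugates_closure Z.
have [I [h [hG hex _]]] := agree_classes_finite vsG.
have [C [col hcol]] := @square_class_coloring G [::] aG (fun f v _ h => h) tG.
have [pr [prP prI]] := prime_seq.
pose T : finType := (C * {ffun I -> bool})%type.
pose N := #|T|.
pose rep (i : 'I_N.+1) : 'I_N.+1 := odflt i [pick j : 'I_N.+1 | col (pr j)%:R == col (pr i)%:R].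
have repc (i : 'I_N.+1) : col (pr (rep i))%:R = col (pr i)%:R.
  by rewrite /rep; case: pickP => //= j /eqP.
have repE (i j : 'I_N.+1) : col (pr i)%:R = col (pr j)%:R -> rep i = rep j.
  move=> e; rewrite /rep (eq_pick (Q := fun k : 'I_N.+1 => col (pr k)%:R == col (pr j)%:R)); last first.
    by move=> k /=; rewrite e.
  by case: pickP => //= /(_ j); rewrite eqxx.
have pr0 i : (pr i)%:R != 0 :> algC by rewrite pnatr_eq0 -lt0n prime_gt0.
have exd (i : 'I_N.+1) : exists d, fix_stab G [::] d /\ d ^+ 2 = (pr i)%:R * (pr (rep i))%:R.
  have [r hr er] := hcol _ _ (@fix_stab_nat _ [::] aG (pr i)) (@fix_stab_nat _ [::] aG (pr (rep i)))
    (pr0 i) (pr0 (rep i)) (esym (repc i)).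
  by exists r.
have [d hd] := boolp.choice exd.
have dA i : d i \in Aint.
  have [_ e] := hd i; apply: (@root_monic_Aint ('X^2 - (d i ^+ 2)%:P)).
  - by rewrite /root !hornerE subrr.
  - by rewrite monicXnsubC.
  apply/polyOverP => k; rewrite e -natrM coefB coefXn coefC.
  by case: ifP => _; rewrite ?subr0 ?rpredB ?rpred_nat.
have dfix (i : 'I_N.+1) : fix_stab galQ vs (d i).
  move=> f gf hf; have [nu enu] := galQ_rmorph gf; rewrite -enu.
  apply: boolp.contrapT => nd; apply: none; exists nu, (d i); split=> //.
    by move=> z hz; rewrite enu hf // Zvs.
  by apply/fix_stab_nil; case: (hd i).
(* Equal colours give a common representative, so that (d i d j)^2 is p_i p_j times a square and d i
   d j is irrational. Equal flags mean that every automorphism changes both signs or none, and so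
   fixes d i d j. *)
pose phi (i : 'I_N.+1) : T := (col (pr i)%:R, [ffun k : I => h k (d i) == d i]).
have [i [j [nij eij]]] : exists i j, i != j /\ phi i = phi j.
  apply: boolp.contrapT => nex.
  have inj : injective phi.
    move=> i j e; apply/eqP; apply: boolp.contrapT => /negP ne; apply: nex; by exists i, j.
  by have := leq_card _ inj; rewrite card_ord ltnn.
have [ec /ffunP ef] := (congr1 fst eij, congr1 snd eij).
have [_ ei] := hd i; have [_ ej] := hd j; rewrite -(repE _ _ ec) in ej.
have sgn nu' k : (nu' : {rmorphism algC -> algC}) = h k :> (algC -> algC) -> forall l, h k (d l) = d l \/ h k (d l) = - d l.
  move=> enu l; have : h k (d l) ^+ 2 == d l ^+ 2.
    have [_ el] := hd l.
    by rewrite -enu -rmorphXn el -natrM rmorph_nat.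
  by rewrite eqf_sqr => /orP[] /eqP; [left | right].
have d0 l : d l != 0.
  have [_ el] := hd l; apply/negP => /eqP z; have := mulf_neq0 (pr0 l) (pr0 (rep l)).
  by rewrite -el z expr0n eqxx.
have s2 : (d i * d j) ^+ 2 = (pr i * pr j * pr (rep i) ^ 2)%:R.
  by rewrite exprMn ei ej !natrM; ring.
have npr : pr i != pr j by apply: contraNneq nij => /prI e; apply/eqP/val_inj.
have irr := sqrt_primes_irrat (prP i) (prP j) (prP (rep i)) npr s2.
have [nu enu] : exists nu : {rmorphism algC -> algC}, nu (d i * d j) = - (d i * d j).
  by apply: sqrt_conj => //; rewrite s2 rpred_nat.
have gnu := rmorph_galQ nu.
have [k ak] := hex _ gnu.
have el l : nu (d l) = h k (d l).
  exact: (agree_fix_stab galQ_autgroup gnu (hG k) ak (dfix l)).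
have [nu' enu'] := galQ_rmorph (hG k).
have neg l : (- d l == d l) = false.
  by rewrite eq_sym -addr_eq0 -mulr2n mulrn_eq0 (negbTE (d0 l)).
have := ef k; rewrite !ffunE => sg.
have : nu (d i * d j) = d i * d j.
  move: sg; rewrite rmorphM /= !el.
  by case: (sgn nu' k enu' i) => ->; case: (sgn nu' k enu' j) => ->; rewrite ?eqxx ?neg ?mulrNN.
move/eqP; rewrite enu eq_sym -addr_eq0 -mulr2n mulrn_eq0 /= mulf_eq0.
by rewrite (negbTE (d0 i)) (negbTE (d0 j)).
Qed.

(** * Differences of points near a fixed abscissa *)

Section NearPoint.
Variables (F : fieldType) (O : F -> Prop) (E : curve F).
Hypothesis vO : valring O.
Local Notation A := (cA E).
Local Notation B := (cB E).
Hypotheses (OA : O A) (OB : O B).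
Local Notation dv := (dv O).
Local Notation two := (2%:R : F).

Let O2k k : O (two ^+ k). Proof. by apply: (vrX vO); apply: (vr_nat vO). Qed.
Let two0 k : two ^+ k != 0. Proof. by rewrite expf_neq0 // (two_vr_neq0 vO). Qed.

Variables (e : F) (a K : nat).
Hypotheses (Oe : O e) (haK : (a < K)%N).

(** The product (Y - h) (Y + h) is divisible by 2^K, but 2^(a+1) cannot divide both factors, since
    their difference 2 h divides 2^a. The other factor takes all but a + 1 of the powers of 2. *)
Lemma near_pt_sign h d Y : O h -> h ^+ 2 = e ^+ 3 + A * e + B -> dv (two * h) (two ^+ a) ->
  dv (two ^+ K) d -> Y ^+ 2 = (e + d) ^+ 3 + A * (e + d) + B ->
  dv (two ^+ (K - a.+1)) (Y - h) \/ dv (two ^+ (K - a.+1)) (Y + h).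
Proof.
move=> Oh eh ha hd eY.
have Od : O d by apply: dv_vr hd.
have prod : dv (two ^+ K) ((Y - h) * (Y + h)).
  have -> : (Y - h) * (Y + h) = d * (3%:R * e ^+ 2 + 3%:R * e * d + d ^+ 2 + A).
    by rewrite -subr_sqr eY eh; ring.
  apply: dvMr => //; do ![apply: (vrD vO) => //].
  - by apply: (vrM vO); [apply: (vr_nat vO) | apply: (vrX vO)].
  - by do !apply: (vrM vO) => //; apply: (vr_nat vO).
  - exact: (vrX vO).
have key p q : dv (two ^+ K) (p * q) -> dv q (two ^+ a.+1) -> dv (two ^+ (K - a.+1)) p.
  move=> [c Oc ec] [s Os es]; exists (c * s); first exact: (vrM vO).
  apply: (mulIf (two0 a.+1)); have -> : p * two ^+ a.+1 = p * q * s by rewrite es mulrA.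
  by rewrite ec -[in LHS](subnK haK) exprD; ring.
case: (dv_total vO (two ^+ a.+1) (Y + h)) => h1; last by left; apply: key prod h1.
case: (dv_total vO (two ^+ a.+1) (Y - h)) => h2; last first.
  by right; apply: key h2; rewrite mulrC.
exfalso; apply: (@not_dv_exp2S _ _ vO a); apply: dv_trans ha => //.
have -> : two * h = (Y + h) - (Y - h) by ring.
exact: dvB.
Qed.

(** The chord through P and -P' has slope 1/v with v = (d - d') / (Y + Y'), and v is close to [z]
    because Y + Y' is close to 2 h. So the sum is near the origin with parameter close to [- z]. The
    error carries the factor [z], since d - d' has no lower bound. *)
Lemma near_pt_diff h d d' Y Y' (P P' : point E) : O h -> dv (two * h) (two ^+ a) ->
  (a.*2.+2 < K)%N ->
  dv (two ^+ K) d -> dv (two ^+ K) d' ->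
  pval P = Some (e + d, Y) -> pval P' = Some (e + d', Y') ->
  dv (two ^+ (K - a.+1)) (Y - h) -> dv (two ^+ (K - a.+1)) (Y' - h) ->
  let z := (d - d') / (two * h) in
  near0 O z (pval (P - P')) /\
  dv (two ^+ (K - a.*2.+1) * z) (tpar (pval (P - P')) + z).
Proof.
move=> Oh ha hK hd hd' eP eP' hY hY' z.
have h0 : two * h != 0.
  by apply/negP => /eqP e0; move: ha => [c _]; rewrite e0 mul0r => /eqP; rewrite (negbTE (two0 a)).
have Od : O d by apply: dv_vr hd.
have Od' : O d' by apply: dv_vr hd'.
have divh i x : (a <= i)%N -> dv (two ^+ i) x -> dv (two ^+ (i - a)) (x / (two * h)).
  move=> ai [c Oc ->]; have [s Os es] := ha; exists (s * c); first exact: (vrM vO).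
  by rewrite -[in LHS](subnK ai) exprD es; field; move: h0; rewrite mulf_eq0 negb_or => /andP[-> ->].
have hKa : (a.*2.+1 <= K)%N by apply: leq_trans hK; rewrite ltnW.
have ale : (a <= K - a.+1)%N by rewrite leq_subRL // addSn addnn.
have eKa : (K - a.*2.+1 = K - a.+1 - a)%N by rewrite -subnDA addSn addnn.
pose r := ((Y - h) + (Y' - h)) / (two * h).
have hr : dv (two ^+ (K - a.*2.+1)) r by rewrite eKa; apply: divh => //; apply: dvD.
have K1 : (0 < K - a.*2.+1)%N by rewrite subn_gt0 ltnW.
have hr2 : dv two r by apply: (@dv_exp2 _ _ vO 1) hr.
have [u0 uV] : 1 + r != 0 /\ O (1 + r)^-1.
  by apply: (unit_dv vO); rewrite addrC addKr.
have eYY : Y + Y' = two * h * (1 + r) by rewrite /r; field; move: h0; rewrite mulf_eq0 negb_or => /andP[-> ->].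
have YY0 : Y + Y' != 0 by rewrite eYY mulf_neq0.
have hz : dv (two ^+ (K - a)) z by apply: divh => //; [apply: ltnW | apply: dvB].
have Oz : O z by apply: dv_vr hz.
have [edd|ndd] := eqVneq d d'.
  have z0 : z = 0 by rewrite /z edd subrr mul0r.
  suff -> : P - P' = 0 by rewrite /= z0 addr0; split=> //; apply: dv0.
  apply/eqP; rewrite subr_eq0; apply/eqP/val_inj; rewrite /= eP eP' edd.
  congr (Some (_, _)).
  have oP := valP P; have oP' := valP P'; rewrite /= eP in oP; rewrite /= eP' in oP'.
  by rewrite -edd in oP'; apply: (on_ec_eqx oP oP'); apply: negbTE.
set U := e + d in eP *; set U' := e + d' in eP' *.
have UU : U - U' = d - d' by rewrite /U /U'; ring.
have d0 : d - d' != 0 by rewrite subr_eq0.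
have nUU : U' - U != 0 by rewrite -oppr_eq0 opprB UU.
pose v := (d - d') / (Y + Y').
have v0 : v != 0 by rewrite mulf_neq0 ?invr_eq0.
have ev : v = z * (1 + r)^-1.
  by rewrite /v /z eYY invfM mulrA.
have OU : O U by apply: (vrD vO).
have OU' : O U' by apply: (vrD vO).
have OY : O Y.
  have -> : Y = (Y - h) + h by ring.
  by apply: (vrD vO) => //; apply: dv_vr hY.
have hvz : dv z v by rewrite ev; apply: dvMr => //; apply: dv_refl.
have Ov : O v by apply: dv_vr hvz.
have hv : dv (two ^+ (K - a)) v by apply: dv_trans hvz.
have Ka : (0 < K - a)%N by rewrite subn_gt0.
have hv2 : dv two v by apply: (@dv_exp2 _ _ vO 1) hv.
pose den := 1 - v * ((two * U + U') * v - Y * v ^+ 2).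
have [den0 denV] : den != 0 /\ O den^-1.
  apply: (unit_1sub vO); apply: dvMr => //.
  apply: (vrB vO); apply: (vrM vO) => //; last exact: (vrX vO).
  by apply: (vrD vO) => //; apply: (vrM vO) => //; apply: (vr_nat vO).
have eD : pval (P - P') = Some ((1 - (U + U') * v ^+ 2) / v ^+ 2, - den / v ^+ 3).
  rewrite pvalD pvalN eP eP' [opp_ec _]/= /add_ec.
  have -> : (U == U') = false by apply/negbTE; rewrite eq_sym -subr_eq0.
  rewrite /= /third.
  have -> : (- Y' - Y) / (U' - U) = v^-1.
    have -> : U' - U = - (d - d') by rewrite -UU; ring.
    by rewrite /v invf_div -opprD [Y' + Y]addrC invrN mulrNN.
  congr (Some (_, _)); first by field.
  by rewrite /den; field.
have et : tpar (pval (P - P')) = - v * (1 - (U + U') * v ^+ 2) / den.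
  by rewrite eD /=; field; rewrite ?oppr_eq0 ?v0 ?den0.
have etv : tpar (pval (P - P')) + v = v * (v ^+ 2 * ((Y * v - U) / den)).
  rewrite et; apply: (mulIf den0).
  transitivity (- v * (1 - (U + U') * v ^+ 2) + v * den); first by rewrite mulrDl divfK.
  transitivity (v * (v ^+ 2 * (Y * v - U))); first by rewrite /den; ring.
  by rewrite -!mulrA mulVf // mulr1.
have Oden : O ((Y * v - U) / den).
  by apply: (vrM vO) => //; apply: (vrB vO) => //; apply: (vrM vO).
split.
  rewrite eD /near0; split.
  - by rewrite mulf_neq0 ?oppr_eq0 // invr_eq0 expf_neq0.
  - have -> : (1 - (U + U') * v ^+ 2) / v ^+ 2 / (- den / v ^+ 3) = tpar (pval (P - P')) by rewrite eD.
    rewrite et; apply: dvMr => //; apply: (dvMr vO); first exact: (dvN vO hvz).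
    apply: (vrB vO); first exact: (vr1 vO).
    by apply: (vrM vO); [apply: (vrD vO) | apply: (vrX vO)].
  - have -> : (- den / v ^+ 3)^-1 = - (v * (v ^+ 2 * den^-1)).
      by rewrite invfM invrK invrN mulNr [den^-1 * _]mulrC exprS mulrA.
    by apply: dvN => //; apply: dvMr => //; apply: (vrM vO) => //; apply: (vrX vO).
have -> : tpar (pval (P - P')) + z = (tpar (pval (P - P')) + v) + (z - v) by ring.
apply: dvD => //.
  rewrite etv mulrC; apply: dvM => //; apply: dvMr => //.
  apply: (@dv_exp2 _ _ vO _ (K - a)); last by rewrite expr2; apply: dvMr.
  by rewrite leq_sub2l // -addnn -addnS leq_addr.
have -> : z - v = r * (z * (1 + r)^-1).
  by rewrite ev; apply: (mulIf u0); rewrite mulrBl divfK // mulrA divfK //; ring.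
by apply: dvM => //; apply: dvMr => //; apply: dv_refl.
Qed.

End NearPoint.

Lemma uniform_bound (X : finType) (P : X -> nat -> Prop) :
  (forall x m n, (m <= n)%N -> P x m -> P x n) -> (forall x, exists n, P x n) ->
  exists n, forall x, P x n.
Proof.
move=> mono ex; have [f hf] := boolp.choice ex.
by exists (\max_x f x)%N => x; apply: mono (hf x); apply: leq_bigmax.
Qed.

Lemma pigeonhole_inj (M N : nat) (T : finType) (phi : 'I_M -> T) : (N * #|T| < M)%N ->
  exists t : {ffun 'I_N.+1 -> 'I_M}, injective t /\ forall i j, phi (t i) = phi (t j).
Proof.
move=> h; have [v hv] : exists v, (N < #|[pred i | phi i == v]|)%N.
  apply: boolp.contrapT => nex; move: h; apply/negP; rewrite -leqNgt.
  have {1}<- : (\sum_(v : T) #|[pred i | phi i == v]| = M)%N.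
    rewrite -[RHS]card_ord -sum1_card (partition_big phi predT) //=.
    by apply: eq_bigr => v _; rewrite sum1_card; apply: eq_card.
  rewrite mulnC -sum_nat_const; apply: leq_sum => v _; rewrite leqNgt; apply/negP => hv.
  by apply: nex; exists v.
pose A := [pred i | phi i == v].
exists [ffun i => enum_val (widen_ord hv i)]; split.
  move=> i j; rewrite !ffunE => /enum_val_inj/(congr1 val) /= e; exact: val_inj.
move=> i j; rewrite !ffunE.
by have /eqP -> := enum_valP (widen_ord hv i); have /eqP -> := enum_valP (widen_ord hv j).
Qed.

Section Det.
Variables (F : fieldType) (O : F -> Prop).
Hypothesis vO : valring O.

Lemma vr_det n (M : 'M[F]_n) : (forall i j, O (M i j)) -> O (\det M).
Proof.
move=> hM; rewrite /determinant; apply: (vr_sum vO) => s; apply: (vrM vO).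
  by apply: (vrX vO); apply: (vrN vO); apply: (vr1 vO).
by apply: big_ind => //; [apply: (vr1 vO) | apply: (vrM vO)].
Qed.

(** Cramer's rule: the adjugate matrix has entries in [O]. *)
Lemma dv_det n (M : 'M[F]_n) (r : 'I_n -> F) m : (forall i j, O (M i j)) ->
  (forall j, dv O m (\sum_i M j i * r i)) -> forall i, dv O m (\det M * r i).
Proof.
move=> hM h i; pose c : 'cV[F]_n := \col_i r i.
have e : \det M * r i = (\adj M *m (M *m c)) i 0.
  by rewrite mulmxA mul_adj_mx mul_scalar_mx !mxE.
rewrite e mxE; apply: (dv_sum vO) => j; apply: (dvMl vO).
  rewrite mxE /cofactor; apply: (vrM vO); first by apply: (vrX vO); apply: (vrN vO); apply: (vr1 vO).
  by apply: vr_det => k l; rewrite !mxE.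
have -> : (M *m c) j 0 = \sum_i M j i * r i; last exact: h.
by rewrite mxE; apply: eq_bigr => k _; rewrite mxE.
Qed.

End Det.

(* The two Vandermonde determinants are read off from root counting. *)
Lemma powersum_det (F : fieldType) (n : nat) (w : 'I_n -> F) (t : 'I_n.+1 -> F) :
  injective w -> injective t ->
  \det (\matrix_(j < n, i < n) \sum_(k < n) (t (lift ord0 j) ^+ k.+1 - t ord0 ^+ k.+1) * w i ^+ k) != 0.
Proof.
move=> wI tI; rewrite -det_tr; apply/det0P => -[v v0 e].
pose c k := \sum_i v 0 i * w i ^+ k.
(* The constant term makes [t ord0] a root, and the kernel equations make the other [t j] roots: n +
   1 roots for degree at most n. *)
pose p : {poly F} := \poly_(k < n.+1) (if k is k'.+1 then c k' else - \sum_(k < n) c k * t ord0 ^+ k.+1).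
have pE x : p.[x] = \sum_(k < n) c k * (x ^+ k.+1 - t ord0 ^+ k.+1).
  rewrite horner_poly big_ord_recl /= expr0 mulr1 addrC -sumrB.
  by apply: eq_bigr => k _; rewrite mulrBr.
have rp j : root p (t j).
  apply/rootP; rewrite pE; case: (unliftP ord0 j) => [j' ->|->]; last first.
    by rewrite big1 // => k _; rewrite subrr mulr0.
  have := congr1 (fun M : 'rV_n => M 0 j') e; rewrite [RHS]mxE => e0; apply: etrans e0.
  rewrite mxE; under [RHS]eq_bigr do rewrite !mxE mulr_sumr.
  rewrite [RHS]exchange_big /=; apply: eq_bigr => k _; rewrite /c mulr_suml.
  by apply: eq_bigr => i _; ring.
have p0 : p = 0.
  apply/eqP; apply: contraT => pn0.
  have := max_poly_roots pn0 (rs := codom t).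
  rewrite map_inj_uniq ?enum_uniq // size_codom card_ord ltnNge size_poly.
  by move=> /(_ _ isT); apply; apply/allP => _ /codomP[j ->].
have c0 k : (k < n)%N -> c k = 0.
  by move=> lt; have := congr1 (fun q : {poly F} => q`_k.+1) p0; rewrite coef_poly ltnS lt coef0.
have qv (q : {poly F}) : (size q <= n)%N -> \sum_i v 0 i * q.[w i] = 0.
  move=> sq; under eq_bigr do rewrite (horner_coef_wide _ sq) mulr_sumr.
  rewrite exchange_big /= big1 // => k _.
  rewrite (eq_bigr (fun i => q`_k * (v 0 i * w i ^+ k))); last by move=> i _; ring.
  by rewrite -mulr_sumr -/(c k) c0 ?mulr0.
case/eqP: v0; apply/rowP => i; rewrite [RHS]mxE.
(* By [qv], v is orthogonal to the values at the [w j] of every polynomial of degree below n; this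
   Lagrange polynomial isolates the coordinate i. *)
pose q := \prod_(j < n | j != i) ('X - (w j)%:P).
have sq : (size q <= n)%N.
  rewrite /q -big_filter size_prod_XsubC size_filter -sum1_count sum1_card.
  rewrite (eq_card (B := predC1 i)) // cardC1 card_ord.
  by rewrite prednK //; apply: leq_ltn_trans (ltn_ord i).
have := qv q sq; rewrite (bigD1 i) //= big1 ?addr0.
  move/eqP; rewrite mulf_eq0 => /orP[/eqP //|]; rewrite horner_prod => /prodf_eq0[j nj].
  rewrite !hornerE subr_eq0 => /eqP/wI e'.
  by rewrite e' eqxx in nj.
move=> j nj; apply/eqP; rewrite mulf_eq0; apply/orP; right.
rewrite horner_prod; apply/prodf_eq0; exists j => //; by rewrite !hornerE subrr.
Qed.

(** * Traces and construction of new points *)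

(** The primitive element argument: for i and j distinct the two images differ by a nonzero
    polynomial in c, and some natural number is a root of none of these. *)
Lemma separating_comb n (nu : 'I_n -> {rmorphism algC -> algC}) (ws : seq algC) :
  (forall i j, i != j -> exists2 w, w \in ws & nu i w != nu j w) ->
  exists c : nat, injective (fun i => nu i (\sum_(k < size ws) ws`_k * c%:R ^+ k)).
Proof.
move=> h; pose D i j : {poly algC} := \poly_(k < size ws) (nu i ws`_k - nu j ws`_k).
have D0 i j : i != j -> D i j != 0.
  move=> /h[w hw ne]; apply/negP => /eqP e.
  have lt : (index w ws < size ws)%N by rewrite index_mem.
  have := congr1 (fun q : {poly algC} => q`_(index w ws)) e.
  rewrite coef_poly lt coef0 nth_index // => /eqP; rewrite subr_eq0; exact/negP.
pose P := \prod_i \prod_(j | j != i) D i j.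
have P0 : P != 0.
  by apply/prodf_neq0 => i _; apply/prodf_neq0 => j ne; apply: D0; rewrite eq_sym.
have [c hc] : exists c : nat, P.[c%:R] != 0.
  apply: boolp.contrapT => nex.
  have := max_poly_roots P0 (rs := [seq c%:R | c <- iota 0 (size P)]).
  rewrite map_inj_uniq ?iota_uniq; last by move=> x y /eqP; rewrite eqr_nat => /eqP.
  rewrite size_map size_iota ltnn => /(_ _ isT) hh.
  suff : false by []. apply: hh; apply/allP => _ /mapP[c _ ->].
  by apply/rootP; apply: boolp.contrapT => /eqP ne; apply: nex; exists c.
exists c => i j e; apply/eqP; apply: contraT => ne.
have ev : (D i j).[c%:R] = 0.
  move/eqP: e; rewrite -subr_eq0 => /eqP e0; apply: etrans e0.
  rewrite horner_poly !rmorph_sum /= -sumrB.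
  by apply: eq_bigr => k _; rewrite !rmorphM !rmorphXn /= !rmorph_nat mulrBl.
have /eqP[] := hc; rewrite /P (bigD1 i) //= (bigD1 j) /=; last by rewrite eq_sym.
by rewrite !hornerM ev !mul0r.
Qed.

Section Curve.
Variable E : curve algC.
Hypotheses (intA : cA E \in Num.int) (intB : cB E \in Num.int).
Local Notation A := (cA E).
Local Notation B := (cB E).

Lemma rmorph_cA (nu : {rmorphism algC -> algC}) : nu A = A.
Proof. by have /intrP[z ->] := intA; rewrite rmorph_int. Qed.
Lemma rmorph_cB (nu : {rmorphism algC -> algC}) : nu B = B.
Proof. by have /intrP[z ->] := intB; rewrite rmorph_int. Qed.

Definition coords_in (K : algC -> Prop) (P : point E) : Prop :=
  if pval P is Some (x, y) then K x /\ K y else True.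

Lemma pval_pt_map (nu : {rmorphism algC -> algC}) (P : point E) : pval (pt_map nu P) = map_ec nu (pval P).
Proof. by apply: pval_map; [apply: rmorph_cA | apply: rmorph_cB]. Qed.

Lemma coords_in_pt_map_eq K (nu nu' : {rmorphism algC -> algC}) P : coords_in K P ->
  (forall x, K x -> nu x = nu' x) -> pt_map nu P = pt_map nu' P.
Proof.
move=> h e; apply: val_inj; rewrite /= !pval_pt_map; move: h; rewrite /coords_in.
by case: (pval P) => [[x y]|] //= [hx hy]; rewrite !e.
Qed.

Lemma coords_in_sub K P Q : K 0 -> (forall x y, K x -> K y -> K (x + y)) ->
  (forall x, K x -> K (- x)) -> (forall x y, K x -> K y -> K (x * y)) ->
  (forall x, K x -> K x^-1) -> K 1 -> K A -> coords_in K P -> coords_in K Q -> coords_in K (P - Q).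
Proof.
move=> K0 KD KN KM KV K1 KA; rewrite /coords_in pvalD pvalN.
case: (pval P) => [[x1 y1]|]; last by case: (pval Q) => [[x2 y2]|] //= _ [hx hy]; split=> //; apply KN.
case: (pval Q) => [[x2 y2]|] //= [h1 h2] [h3 h4]; case: ifP => // _; rewrite /third.
have Kn n : K n%:R by elim: n => [|n IH] //; rewrite mulrS; apply KD.
set l := (if _ then _ else _).
have Kl : K l.
  rewrite /l; case: ifP => _; apply KM.
  - by apply KD => //; apply KM; [apply Kn | rewrite expr2; apply KM].
  - by apply KV; apply KM => //; apply Kn.
  - by apply KD; apply KN.
  - by apply KV; apply KD => //; apply KN.
have Kx : K (l ^+ 2 - x1 - x2).
  by rewrite expr2; apply KD; [apply KD; [apply KM | apply KN] | apply KN].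
split=> //; apply KN; apply KD => //; apply KM => //; apply KD => //; exact: (KN _).
Qed.

Variable G : (algC -> algC) -> Prop.
Hypotheses (cG : closed_subgroup G) (tG : top_fin_gen G).
Let aG := closed_autgroup cG.

Section Stable.
Variable vs : seq algC.
Local Notation Fp := (fix_stab G vs).

(** Composing with an element of G permutes the classes of agreement on [vs], hence the summands. *)
Lemma trace_fixed (I : finType) (h : I -> {rmorphism algC -> algC}) (Q : point E) :
  (forall i, G (h i)) -> (forall f, G f -> exists i, agree_on vs f (h i)) ->
  (forall i j, agree_on vs (h i) (h j) -> i = j) -> coords_in Fp Q ->
  coords_in (fixed_field G) (\sum_i pt_map (h i) Q).
Proof.
move=> hG hex huniq oQ; set T := \sum_i _.
suff fixT (nu : {rmorphism algC -> algC}) : G nu -> pt_map nu T = T.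
  have e (f : algC -> algC) : G f -> map_ec f (pval T) = pval T.
    move=> Gf; have [nu enu] := galQ_rmorph (ag_gal aG Gf); rewrite -enu -pval_pt_map fixT //.
    by rewrite enu.
  rewrite /coords_in; move: e; case: (pval T) => [[x y]|] // e.
  by split=> f Gf; have := e f Gf; rewrite /= => -[].
move=> Gnu.
have ex i : exists j, agree_on vs (nu \o h i) (h j) by apply: hex; apply: ag_comp.
have [q hq] := boolp.choice ex.
have qI : injective q.
  move=> i j e; apply: huniq => v hv; apply: (fmorph_inj nu).
  by have := hq i v hv; have := hq j v hv; rewrite /= e => -> ->.
rewrite /T pt_map_sum; [|exact: rmorph_cA | exact: rmorph_cB].
rewrite [RHS](reindex_inj qI) /=; apply: eq_bigr => i _.
have [nu2 e2] := galQ_rmorph (galQ_comp (rmorph_galQ nu) (rmorph_galQ (h i))).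
transitivity (pt_map nu2 Q).
  apply: val_inj; rewrite /= !pval_pt_map e2; case: (pval Q) => [[x y]|] //=.
apply: (coords_in_pt_map_eq oQ) => x hx; rewrite e2.
apply: (agree_fix_stab aG _ (hG (q i)) (hq i) hx); exact: ag_comp.
Qed.

End Stable.
End Curve.

Section Valuations.
Variable O : algC -> Prop.
Hypothesis vO : valring O.
Local Notation two := (2%:R : algC).

Lemma not_dv_nonzero x : x != 0 -> exists k, ~ dv O (two ^+ k) x.
Proof.
move=> x0; have [k hk] := exp2_denom vO x^-1; exists k.+1 => -[c Oc ec].
apply: (@not_dv_exp2S _ _ vO k); exists (c * (two ^+ k * x^-1)); first exact: (vrM vO).
by rewrite mulrA -ec mulrCA mulfV ?mulr1.
Qed.

Lemma not_dv_small_nat m N : (0 < m)%N -> (m < 2 ^ N)%N -> ~ dv O (two ^+ N) m%:R.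
Proof.
move=> m0 mN hd; set v := logn 2 m.
have vN : (v < N)%N.
  rewrite -(ltn_exp2l _ _ (isT : (1 < 2)%N)); apply: leq_ltn_trans mN.
  by apply: dvdn_leq => //; rewrite pfactor_dvdnn.
have em : m = (2 ^ v * m`_(2%N^'))%N by rewrite -p_part partnC.
have od : odd m`_(2%N^').
  by rewrite -coprime2n -[2%N]/(2 ^ 1)%N; apply: (pnat_coprime (pi := 2%N)); [|apply: part_pnat].
have [o0 oV] := vr_odd vO od.
apply: (@not_dv_exp2S _ _ vO v); apply: (dv_exp2 vO vN).
have -> : two ^+ v = m%:R / (m`_(2%N^'))%:R.
  by rewrite {1}em natrM natrX mulfK.
exact: (dvMr vO).
Qed.

End Valuations.

(** * Square values of the cubic from Gallai's theorem *)

Section GoodPoint.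
Variable E : curve algC.
Hypotheses (intA : cA E \in Num.int) (intB : cB E \in Num.int).
Local Notation A := (cA E).
Local Notation B := (cB E).
Local Notation two := (2%:R : algC).
Variable G : (algC -> algC) -> Prop.
Hypotheses (cG : closed_subgroup G) (tG : top_fin_gen G).
Let aG := closed_autgroup cG.
Variable vs : seq algC.
Hypothesis sG : forall f v, galQ f -> v \in vs -> f v \in vs.
Local Notation Fp := (fix_stab G vs).

Lemma square_values (th : 'I_3 -> algC) (e eta : algC) (L : seq algC) :
  (forall x, x ^+ 3 + A * x + B = \prod_k (x - th k)) ->
  (forall k, Fp (th k)) -> Fp e -> Fp eta -> eta ^+ 2 = e ^+ 3 + A * e + B -> eta != 0 ->
  (forall l, l \in L -> Fp l) -> 0 \in L -> 1 \in L ->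
  exists u, [/\ Fp u, forall l, l \in L -> u + l != 0 &
    forall g b, b \in L -> (forall k, b + g / (e - th k) \in L) -> Fp g ->
      exists2 Y, Fp Y & Y ^+ 2 = (e + g / (u + b)) ^+ 3 + A * (e + g / (u + b)) + B].
Proof.
move=> hf Fth Fe Feta eeta eta0 FL L0 L1.
have FD := fix_stabD aG (vs := vs); have FM := fix_stabM aG (vs := vs).
have FV := fix_stabV aG (vs := vs); have FN := fix_stabN aG (vs := vs).
have [C [col hcol]] := square_class_coloring aG (fun f v Gf => sG (ag_gal aG Gf)) tG.
(* Zero gets a colour of its own. As [L] contains 0 and 1, a monochromatic copy x + l z cannot
   consist of zeros only, so it avoids zero. *)
pose cc x : option C := if x == 0 then None else Some (col x).
have [W [hW hc]] := gallai_theorem FD (@fix_stab_nat _ vs aG 0) FL (option C).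
have [[x z] /hW /= [Fx z0] hm] := hc cc; rewrite /monochromatic /= in hm.
have zR : z%:R != 0 :> algC by rewrite pnatr_eq0 -lt0n.
have nz l : l \in L -> x + l *+ z != 0.
  move=> lL; apply/negP => /eqP e0.
  have none l' : l' \in L -> x + l' *+ z = 0.
    move=> l'L; have := hm l l' lL l'L; rewrite /cc e0 eqxx; by case: eqP.
  have e1 := none 0 L0; have e2 := none 1 L1; rewrite mul0rn addr0 in e1.
  by move/eqP: e2; rewrite e1 add0r (negbTE zR).
(* Dividing the copy by z normalises its dilation to 1 and leaves products of two members in the
   same square class. *)
pose u := x / z%:R.
have Fu : Fp u by apply FM => //; apply FV; apply: fix_stab_nat.
have uE l : u + l = (x + l *+ z) / z%:R.
  by rewrite -(mulr_natr l) mulrDl mulfK.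
have sq l l' : l \in L -> l' \in L -> exists2 r, Fp r & r ^+ 2 = (u + l) * (u + l').
  move=> lL l'L; have Fl l1 : l1 \in L -> Fp (x + l1 *+ z).
    move=> h; apply FD => //; rewrite -(mulr_natr l1); apply FM; [exact: FL | exact: fix_stab_nat].
  have ec : col (x + l *+ z) = col (x + l' *+ z).
    by have := hm l l' lL l'L; rewrite /cc (negbTE (nz l lL)) (negbTE (nz l' l'L)) => -[].
  have [r Fr er] := hcol _ _ (Fl l lL) (Fl l' l'L) (nz l lL) (nz l' l'L) ec.
  exists (r / z%:R); first by apply FM => //; apply FV; apply: fix_stab_nat.
  by rewrite !uE expr_div_n er; field.
exists u; split=> //.
  by move=> l lL; rewrite uE mulf_neq0 ?invr_eq0 // nz.
move=> g b bL gL Fg.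
have ub0 : u + b != 0 by rewrite uE mulf_neq0 ?invr_eq0 // nz.
have ex k := sq _ _ bL (gL k).
have exr k : exists r, Fp r /\ r ^+ 2 = (u + b) * (u + (b + g / (e - th k))).
  by have [r Fr er] := ex k; exists r.
have [r hr] := boolp.choice exr.
have eth k : e - th k != 0.
  apply/negP => /eqP z1; case/eqP: eta0; apply/eqP; rewrite -[_ == 0]/(true && (eta == 0)).
  by rewrite -(expf_eq0 eta 2) eeta hf (bigD1 k) //= z1 mul0r.
(* At abscissa e + g / (u + b), the k-th factor of the cubic is (e - th k) (r k / (u + b))^2. *)
exists (eta * \prod_k r k / (u + b) ^+ 3).
  apply FM; last by apply FV; apply: fix_stabX => //; apply FD => //; apply: FL.
  apply FM => //; apply: (big_ind Fp) => [||k _]; [exact: (@fix_stab_nat _ vs aG 1) | exact: (fun a b => FM a b) |].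
  by case: (hr k).
have -> : (eta * \prod_k r k / (u + b) ^+ 3) ^+ 2 = eta ^+ 2 * \prod_k r k ^+ 2 / (u + b) ^+ 6.
  by rewrite expr_div_n exprMn prodrXl -exprM.
rewrite eeta !hf.
have fU k : e + g / (u + b) - th k = (e - th k) * r k ^+ 2 / (u + b) ^+ 2.
  by have [_ ->] := hr k; field; rewrite eth ub0.
under [RHS]eq_bigr do rewrite fU.
rewrite [RHS]big_split [X in _ = X * _]big_split /= prodfV; congr (_ * _ / _).
by rewrite big_const_ord iter_mulr_1 -exprM.
Qed.

End GoodPoint.

(** * A point whose signed sum of conjugates is not torsion *)

Section GoodPoint.
Variable E : curve algC.
Hypotheses (intA : cA E \in Num.int) (intB : cB E \in Num.int).
Local Notation A := (cA E).
Local Notation B := (cB E).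
Local Notation two := (2%:R : algC).
Variable G : (algC -> algC) -> Prop.
Hypotheses (cG : closed_subgroup G) (tG : top_fin_gen G).
Let aG := closed_autgroup cG.
Variable vs : seq algC.
Hypothesis sG : forall f v, galQ f -> v \in vs -> f v \in vs.
Local Notation Fp := (fix_stab G vs).

(** If the signed sums vanished for all N differences [Q j], their linear parts would show that the
    matrix [Mt t] kills the vector of the [rho k], up to signs, modulo [two ^+ J * m0], where [m0]
    is the largest [rho k]. By Cramer's rule 2^J would then divide the determinant, against the
    choice of [J]. *)
Lemma nontorsion_trace_point (th : 'I_3 -> algC) (e : nat) (eta : algC) n
    (nu : 'I_n.+1 -> {rmorphism algC -> algC}) (sg : 'I_n.+1 -> bool) (w0 : algC) :
  (forall x, x ^+ 3 + A * x + B = \prod_k (x - th k)) -> (forall k, Fp (th k)) ->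
  Fp eta -> eta \in Aint -> eta ^+ 2 = e%:R ^+ 3 + A * e%:R + B -> eta != 0 ->
  Fp w0 -> w0 \in Aint -> injective (fun i => nu i w0) ->
  exists2 Q : point E, coords_in Fp Q & forall m, (0 < m)%N ->
    (\sum_k (if sg k then - pt_map (nu k) Q else pt_map (nu k) Q)) *+ m != 0.
Proof.
move=> hf Fth Feta Aeta eeta eta0 Fw Aw wI.
have [O vO] := valring_exists.
have OAint := Aint_vr vO.
have OA : O A by apply: OAint; apply: Aint_Cint.
have OB : O B by apply: OAint; apply: Aint_Cint.
have O2k k : O (two ^+ k) by apply: (vrX vO); apply: (vr_nat vO).
pose N := n.+1.
(* So many indices that N + 1 of them share a sign pattern over the N embeddings. *)
pose M := (N * #|{: {ffun 'I_N -> bool}}|).+1.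
(* With this choice the differences of conjugates form a product of two Vandermonde-type matrices,
   in the indices i and in the distinct conjugates of [w0]; see [powersum_det]. *)
pose gg (i : nat) := \sum_(k < N) i%:R ^+ k.+1 * w0 ^+ k.
have Fn m : Fp m%:R by apply: fix_stab_nat.
have Fgg i : Fp (gg i).
  by apply: fix_stab_sum => // k _; apply: fix_stabM => //; apply: fix_stabX.
have nugg k i : nu k (gg i) = \sum_(l < N) i%:R ^+ l.+1 * nu k w0 ^+ l.
  by rewrite rmorph_sum; apply: eq_bigr => l _; rewrite rmorphM !rmorphXn rmorph_nat.
have Onw k : O (nu k w0) by apply: OAint; rewrite Aint_aut.
pose Mt (t : {ffun 'I_N.+1 -> 'I_M}) : 'M[algC]_N :=
  \matrix_(j < N, i < N) \sum_(k < N)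
     ((t (lift ord0 j))%:R ^+ k.+1 - (t ord0)%:R ^+ k.+1) * nu i w0 ^+ k.
have MtO t i j : O (Mt t i j).
  rewrite mxE; apply: (vr_sum vO) => k; apply: (vrM vO); last exact: (vrX vO).
  by apply: (vrB vO); apply: (vrX vO); apply: (vr_nat vO).
have MtE t j i : Mt t j i = nu i (gg (t (lift ord0 j))) - nu i (gg (t ord0)).
  by rewrite mxE !nugg -sumrB; apply: eq_bigr => k _; rewrite mulrBl.
(* The bound covers all selections [t], since the one to be used depends on u, which depends on
   [J]. *)
have [J hJ] : exists J, forall t : {ffun 'I_N.+1 -> 'I_M}, injective t -> ~ dv O (two ^+ J) (\det (Mt t)).
  apply: uniform_bound.
    by move=> t m m' le h tI hd; apply: (h tI); apply: (dv_exp2 vO le hd).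
  move=> t; case: (boolp.pselect (injective t)) => tI; last by exists 0%N.
  have d0 : \det (Mt t) != 0.
    apply: (powersum_det wI (t := fun j => (t j)%:R)) => j j' /eqP.
    by rewrite eqr_nat => /eqP/val_inj/tI.
  by have [k hk] := not_dv_nonzero vO d0; exists k.
have h20 : two * eta != 0 by rewrite mulf_neq0 // pnatr_eq0.
have [a ha] : exists a, dv O (two * eta) (two ^+ a).
  have [a ha] := exp2_denom vO (two * eta)^-1; exists a; exists (two ^+ a * (two * eta)^-1) => //.
  by rewrite mulrCA mulfV // mulr1.
(* The 3 provides [a.*2.+2 < K], as [near_pt_diff] demands, and [J] brings its relative error below
   2^J. Moreover [K - a] exceeds both 2 and [J], which is used for [m04] and [m0J]. *)
pose K := (a.*2 + J + 3)%N.
have aK : (a < K)%N by rewrite /K; lia.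
have aK2 : (a.*2.+2 < K)%N by rewrite /K; lia.
have KJ : (J <= K - a.*2.+1)%N by rewrite /K; lia.
(* The extra factor 2^N pays for the division by the conjugates of u + b, which divide 2^N by
   [nbdv]. *)
pose gm i := two ^+ (K + N) * gg i.
have Fgm i : Fp (gm i) by apply: fix_stabM => //; apply: fix_stabX.
pose Lb : seq algC := [seq b%:R | b <- iota 0 N.+1].
pose Lg : seq algC := 0 :: [seq gm i / (e%:R - th k) | i <- iota 0 M, k <- enum 'I_3].
pose L := [seq b + g | b <- Lb, g <- Lg].
have inLb b : (b < N.+1)%N -> b%:R \in Lb by move=> lt; apply: map_f; rewrite mem_iota.
have inL0 b : (b < N.+1)%N -> b%:R \in L.
  move=> lt; apply/allpairsP; exists (b%:R, 0); rewrite addr0; split=> //=; [exact: inLb | exact: mem_head].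
have inLg b i k : (b < N.+1)%N -> (i < M)%N -> b%:R + gm i / (e%:R - th k) \in L.
  move=> lt lti; apply/allpairsP; exists (b%:R, gm i / (e%:R - th k)); split=> //=; first exact: inLb.
  rewrite inE; apply/orP; right; apply/allpairsP; exists (i, k).
  by split; rewrite ?mem_iota ?mem_enum.
have FL l : l \in L -> Fp l.
  move=> /allpairsP[[b g] /= [/mapP[b' _ ->] hg ->]]; apply: fix_stabD => //.
  move: hg; rewrite inE => /orP[/eqP ->|/allpairsP[[i k] /= [_ _ ->]]]; first exact: (Fn 0%N).
  apply: fix_stabM => //; apply: fix_stabV => //; apply: fix_stabD => //; exact: fix_stabN.
have [u [Fu u0 hY]] := square_values cG tG sG hf Fth (Fn e) Feta eeta eta0 FL (inL0 0%N isT) (inL0 1%N isT).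
(* Each of the N embeddings excludes at most one of the N + 1 values: two values excluded by the
   same one would differ by a multiple of 2^N, yet they differ by at most N. *)
have [b hb] : exists b : 'I_N.+1, forall k, ~ dv O (two ^+ N) (nu k u + b%:R).
  apply: boolp.contrapT => nex.
  have ex (b : 'I_N.+1) : exists k, dv O (two ^+ N) (nu k u + b%:R).
    apply: boolp.contrapT => nk; apply: nex; exists b => k hk; apply: nk; by exists k.
  have [q hq] := boolp.choice ex.
  have qI : injective q.
    have wl (b b' : 'I_N.+1) : (b < b')%N -> q b = q b' -> False.
      move=> lt eq; have h1 := hq b; have h2 := hq b'; rewrite -eq in h2.
      apply: (@not_dv_small_nat O vO (b' - b)%N N).
      - by rewrite subn_gt0.
      - apply: leq_ltn_trans (ltn_expl N (isT : (1 < 2)%N)).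
        by apply: leq_trans (leq_subr _ _) _; rewrite -ltnS.
      rewrite natrB ?(ltnW lt) //.
      have -> : b'%:R - b%:R = (nu (q b) u + b'%:R) - (nu (q b) u + b%:R) :> algC by ring.
      exact: (dvB vO).
    move=> b b' eq; apply: val_inj; case: (ltngtP b b') => // lt; exfalso; first exact: wl lt eq.
    exact: wl lt (esym eq).
  by have := leq_card _ qI; rewrite !card_ord ltnn.
have nb0 k : nu k u + b%:R != 0.
  by apply/negP => /eqP z0; apply: (hb k); rewrite z0; apply: (dv0 vO).
have nbdv k : dv O (nu k u + b%:R) (two ^+ N).
  by case: (dv_total vO (two ^+ N) (nu k u + b%:R)) => // h; case: (hb k).
pose U (i : 'I_M) := e%:R + gm i / (u + b%:R).
have exY (i : 'I_M) : exists P : point E, coords_in Fp P /\ exists Y, pval P = Some (U i, Y).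
  have [Y FY eY] := hY (gm i) b%:R (inL0 b (ltn_ord b)) (fun k => inLg b i k (ltn_ord b) (ltn_ord i)) (Fgm i).
  have oP : on_ec E (Some (U i, Y)) by apply/eqP.
  exists (Point oP); split; last by exists Y.
  split=> //; apply: fix_stabD => //; apply: fix_stabM => //; apply: fix_stabV => //.
  exact: fix_stabD.
have [P hP] := boolp.choice exY.
have exY2 i : exists Y, pval (P i) = Some (U i, Y) by case: (hP i).
have [Y hPY] := boolp.choice exY2.
pose d i k := nu k (gm i) / (nu k u + b%:R).
have nuU k i : nu k (U i) = e%:R + d i k.
  by rewrite rmorphD rmorph_nat fmorph_div rmorphD rmorph_nat.
have nuP k i : pval (pt_map (nu k) (P i)) = Some (e%:R + d i k, nu k (Y i)).
  by rewrite pval_pt_map // hPY /= nuU.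
have nugm k i : nu k (gm i) = two ^+ (K + N) * nu k (gg i).
  by rewrite rmorphM rmorphXn rmorph_nat.
have Onugg k i : O (nu k (gg i)).
  rewrite nugg; apply: (vr_sum vO) => l; apply: (vrM vO); apply: (vrX vO) => //; exact: (vr_nat vO).
have hd i k : dv O (two ^+ K) (d i k).
  have [c Oc ec] := nbdv k; exists (c * nu k (gg i)); first exact: (vrM vO).
  by rewrite /d nugm exprD ec; field.
have Oe : O e%:R by apply: (vr_nat vO).
have Oeta k : O (nu k eta) by apply: OAint; rewrite Aint_aut.
have eetak k : nu k eta ^+ 2 = e%:R ^+ 3 + A * e%:R + B.
  by rewrite -rmorphXn eeta !rmorphD rmorphXn rmorphM rmorph_nat rmorph_cA // rmorph_cB.
have nueta k : nu k eta = eta \/ nu k eta = - eta.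
  have : nu k eta ^+ 2 == eta ^+ 2 by rewrite eetak eeta.
  by rewrite eqf_sqr => /orP[] /eqP; [left | right].
have ha' k : dv O (two * nu k eta) (two ^+ a).
  case: (nueta k) => -> //; have [c Oc ->] := ha; exists (- c); first exact: (vrN vO).
  by ring.
pose good (b : bool) i k := dv O (two ^+ (K - a.+1)) (nu k (Y i) - (if b then nu k eta else - nu k eta)).
have sgn i k : good true i k \/ good false i k.
  rewrite /good opprK; apply: (near_pt_sign vO OA Oe aK (Oeta k) (eetak k) (ha' k) (hd i k)).
  by have := valP (pt_map (nu k) (P i)); rewrite [val _]nuP => /eqP.
pose phi (i : 'I_M) : {ffun 'I_N -> bool} := [ffun k => boolp.asbool (good true i k)].
have goodphi i k : good (phi i k) i k.
  rewrite ffunE; case: (boolp.pselect (good true i k)) => h.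
    by rewrite (boolp.asboolT h).
  by rewrite (boolp.asboolF h); case: (sgn i k).
have [t [tI ht]] := @pigeonhole_inj M N _ phi (ltnSn _).
pose h k := if phi (t ord0) k then nu k eta else - nu k eta.
have Oh k : O (h k) by rewrite /h; case: ifP => // _; apply: (vrN vO).
have hah k : dv O (two * h k) (two ^+ a).
  rewrite /h; case: ifP => _ //; have [c Oc ->] := ha' k; exists (- c); first exact: (vrN vO).
  by ring.
have h0 k : two * h k != 0.
  have nk : nu k eta != 0 by rewrite fmorph_eq0.
  by rewrite mulf_neq0 ?pnatr_eq0 // /h; case: ifP; rewrite ?oppr_eq0.
have hYh j k : dv O (two ^+ (K - a.+1)) (nu k (Y (t j)) - h k).
  by rewrite /h (ht ord0 j); apply: goodphi.
pose Q j := P (t (lift ord0 j)) - P (t ord0).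
pose rho k := two ^+ (K + N) / ((nu k u + b%:R) * (two * h k)).
have nuQ k j : pt_map (nu k) (Q j) =
    pt_map (nu k) (P (t (lift ord0 j))) - pt_map (nu k) (P (t ord0)).
  by rewrite /Q pt_mapD ?pt_mapN //; [exact: rmorph_cA | exact: rmorph_cB | exact: rmorph_cA | exact: rmorph_cB].
have main j k : near0 O (Mt t j k * rho k) (pval (pt_map (nu k) (Q j))) /\
    dv O (two ^+ J * (Mt t j k * rho k)) (tpar (pval (pt_map (nu k) (Q j))) + Mt t j k * rho k).
  have -> : Mt t j k * rho k = (d (t (lift ord0 j)) k - d (t ord0) k) / (two * h k).
    rewrite MtE /rho /d !nugm; field; rewrite nb0 /=.
    by have := h0 k; rewrite mulf_eq0 negb_or => /andP[_ ->].
  rewrite nuQ; have [m1 m2] := near_pt_diff vO Oe aK (Oh k) (hah k) aK2 (hd _ _) (hd _ _)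
     (nuP k _) (nuP k _) (hYh (lift ord0 j) k) (hYh ord0 k).
  split=> //; apply: dv_trans m2 => //; apply: (dvM vO); last exact: (dv_refl vO).
  by apply: (dv_exp2 vO KJ); apply: (dv_refl vO).
have rho0 k : rho k != 0.
  by rewrite mulf_neq0 ?expf_neq0 ?pnatr_eq0 // invr_eq0 mulf_neq0.
have rhoK k : dv O (two ^+ (K - a)) (rho k).
  have [c Oc ec] := nbdv k; have [c' Oc' ec'] := hah k; exists (c * c'); first exact: (vrM vO).
  rewrite /rho exprD -{1}(subnK (ltnW aK)) exprD ec ec'; field; rewrite nb0 /=.
  by have := h0 k; rewrite mulf_eq0 negb_or => /andP[_ ->].
(* All conjugate points are near the origin to the precision [m0], as it divides every [rho k]. *)
have [ks hks] := dv_max vO rho.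
set m0 := rho ks in hks.
have m0K := rhoK ks; rewrite -/m0 in m0K.
have m04 : dv O 4%:R m0.
  have -> : 4%:R = two ^+ 2 by rewrite -natrX.
  by apply: (dv_exp2 vO _ m0K); rewrite /K; lia.
have m02 : dv O two m0.
  apply: dv_trans m04 => //; exists two; [exact: (O2k 1%N) | by rewrite -natrM].
have Om0 : O m0 by apply: dv_vr m02 => //; apply: (O2k 1%N).
have zm j k : dv O m0 (Mt t j k * rho k) by apply: (dvMl vO).
pose s b (x : point E) := if b then - x else x.
pose sr (b : bool) (x : algC) := if b then - x else x.
have sQ j k : near0 O m0 (pval (s (sg k) (pt_map (nu k) (Q j)))) /\
    dv O (two ^+ J * m0) (tpar (pval (s (sg k) (pt_map (nu k) (Q j)))) + sr (sg k) (Mt t j k * rho k)).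
  have [m1 m2] := main j k.
  have m1' := near0_trans vO (zm j k) m1.
  have m2' : dv O (two ^+ J * m0) (tpar (pval (pt_map (nu k) (Q j))) + Mt t j k * rho k).
    by apply: dv_trans m2 => //; apply: (dvM vO) => //; apply: (dv_refl vO).
  rewrite /s /sr; case: (sg k) => //; rewrite pvalN.
  have [m3 ->] := near0_opp vO m1'; split=> //.
  by rewrite -opprD; apply: (dvN vO).
have sum_near j := @near0_sum _ _ _ vO OA OB _ _ (index_enum 'I_n.+1) _ m02 (fun k => (sQ j k).1).
apply: boolp.contrapT => nogood.
have Sz j : \sum_k s (sg k) (pt_map (nu k) (Q j)) = 0.
  apply: boolp.contrapT => /eqP nz; apply: nogood; exists (Q j).
    by apply: coords_in_sub => //; [exact: (Fn 0%N) | exact: fix_stabD | exact: fix_stabN | exact: fix_stabM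
      | exact: fix_stabV | exact: (Fn 1%N) | have /intrP[z ->] := intA; apply: fix_stab_rat => //; apply: rpred_int | case: (hP (t (lift ord0 j))) | case: (hP (t ord0))].
  move=> m mgt; apply: (near0_torsionfree vO OA OB) => //.
  by have [h1 _] := sum_near j; apply: near0_trans h1.
apply: (hJ t tI).
have key := @dv_det _ _ vO _ (Mt t) (fun k => sr (sg k) (rho k)) (two ^+ J * m0) (MtO t).
have {}key : forall k, dv O (two ^+ J * m0) (\det (Mt t) * sr (sg k) (rho k)).
  apply: key => j; have [_ h2] := sum_near j; rewrite Sz /= sub0r in h2.
  (* The quadratic error of the formal addition is harmless because [m0] is itself divisible by
     2^J. *)
  have m0J : dv O (two ^+ J * m0) (m0 ^+ 2).
    rewrite expr2; apply: (dvM vO); last exact: (dv_refl vO).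
    by apply: (dv_exp2 vO _ m0K); rewrite /K; lia.
  have h3 : dv O (two ^+ J * m0) (- \sum_k tpar (pval (s (sg k) (pt_map (nu k) (Q j))))).
    exact: dv_trans m0J h2.
  have h4 : dv O (two ^+ J * m0) (\sum_k (tpar (pval (s (sg k) (pt_map (nu k) (Q j)))) + sr (sg k) (Mt t j k * rho k))).
    by apply: (dv_sum vO) => k; case: (sQ j k).
  have := dvD vO h3 h4; rewrite big_split /= addKr; congr (dv O _ _).
  by apply: eq_bigr => k _; rewrite /sr; case: (sg k) => //; rewrite mulrN.
have [c Oc ec] := key ks; exists (sr (sg ks) c); first by rewrite /sr; case: (sg ks) => //; apply: (vrN vO).
apply: (mulIf (rho0 ks)); rewrite -/m0; move: ec; rewrite /sr -/m0.
case: (sg ks) => // ec; last by rewrite ec mulrAC.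
by rewrite -[LHS]opprK -mulrN ec; ring.
Qed.

End GoodPoint.

Lemma Aint_sqrtC_int (x : algC) : x \in Num.int -> sqrtC x \in Aint.
Proof.
move=> xI; apply: (@root_monic_Aint ('X^2 - x%:P)); last first.
- apply/polyOverP => k; rewrite coefB coefXn coefC.
  by case: ifP => _; rewrite ?subr0 ?rpredB ?rpred_nat.
- by rewrite monicXnsubC.
by rewrite /root !hornerE sqrtCK subrr.
Qed.

(** * Independent points over the fixed field *)

Section MainStep.
Variable E : curve algC.
Hypotheses (intA : cA E \in Num.int) (intB : cB E \in Num.int).
Local Notation A := (cA E).
Local Notation B := (cB E).

Lemma cubic_roots : exists th : 'I_3 -> algC,
  (forall x, x ^+ 3 + A * x + B = \prod_k (x - th k)) /\ forall k, th k \in Aint.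
Proof.
pose q : {poly algC} := A *: 'X + B%:P.
have sq : (size q < size ('X^3 : {poly algC}))%N.
  rewrite size_polyXn ltnS; apply: leq_trans (size_polyD _ _) _; rewrite geq_max.
  apply/andP; split; first by apply: leq_trans (size_scale_leq _ _) _; rewrite size_polyX.
  by apply: leq_trans (size_polyC_leq1 _) _.
pose p := 'X^3 + q.
have sp : size p = 4%N by rewrite size_polyDl // size_polyXn.
have mp : p \is monic by rewrite monicE lead_coefDl // lead_coefXn.
have pE x : p.[x] = x ^+ 3 + A * x + B by rewrite /p /q !(hornerD, hornerXn, hornerZ, hornerX, hornerC) addrA.
have [rs ers] := closed_field_poly_normal p.
rewrite (eqP mp) scale1r in ers.
have srs : size rs = 3%N by move: sp; rewrite ers size_prod_XsubC => -[].
exists (fun k => rs`_k); split.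
  move=> x; rewrite -pE ers horner_prod (big_nth 0) srs big_mkord.
  by apply: eq_bigr => k _; rewrite !hornerE.
move=> k; apply: (root_monic_Aint _ mp).
  by rewrite ers root_prod_XsubC mem_nth // srs.
apply/polyOverP => i; rewrite coefD coefXn coefD coefZ coefX coefC.
apply: rpredD; first exact: rpred_nat.
apply: rpredD; first by apply: rpredM => //; apply: rpred_nat.
by case: ifP => // _; apply: rpred0.
Qed.

Lemma nonroot_nat : exists e : nat, e%:R ^+ 3 + A * e%:R + B != 0.
Proof.
have [th [hth _]] := cubic_roots.
apply: boolp.contrapT => nex.
have ex (e : 'I_4) : exists k, th k = e%:R.
  have /eqP : e%:R ^+ 3 + A * e%:R + B = 0.
    by apply: boolp.contrapT => /eqP ne; apply: nex; exists e.
  by rewrite hth => /prodf_eq0[k _]; rewrite subr_eq0 => /eqP ->; exists k.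
have [f hf] := boolp.choice ex.
have fI : injective f.
  by move=> i j e; apply: val_inj; apply/eqP; rewrite -(eqr_nat algC) -!hf e.
by have := leq_card _ fI; rewrite !card_ord.
Qed.

Variable G : (algC -> algC) -> Prop.
Hypotheses (cG : closed_subgroup G) (tG : top_fin_gen G).
Let aG := closed_autgroup cG.

(** The embeddings involved are the [h i] and the [nu \o h i], the latter with a minus sign. Two of
    the same kind differ on [vs]; two of different kinds differ at d, which lies in F and so is
    fixed by the [h i], whereas [nu] moves it. A combination [w0] of [vs] and d separates them
    all. *)
Lemma new_point (Z : seq algC) : exists (T : point E) (nu : {rmorphism algC -> algC}),
  [/\ coords_in (fixed_field G) T, forall z, z \in Z -> nu z = z &
      forall m, (0 < m)%N -> (T - pt_map nu T) *+ m != 0].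
Proof.
have [nu [d [nuZ Fd dA nd]]] := moving_automorphism_exists Z cG tG.
have [th [hth thA]] := cubic_roots.
have [e he] := nonroot_nat.
pose eta := sqrtC (e%:R ^+ 3 + A * e%:R + B).
have eta2 : eta ^+ 2 = e%:R ^+ 3 + A * e%:R + B by rewrite sqrtCK.
have eta0 : eta != 0 by rewrite sqrtC_eq0.
have etaA : eta \in Aint.
  by apply: Aint_sqrtC_int; rewrite !rpredD ?rpredM ?rpredX ?rpred_nat.
have [vs [Zvs vsG vsA]] := conjugates_closure (eta :: [seq th k | k <- enum 'I_3]).
have {}vsA : {subset vs <= Aint}.
  by apply: vsA => x; rewrite inE => /orP[/eqP ->|/mapP[k _ ->]].
have vs_eta : eta \in vs by apply: Zvs; rewrite mem_head.
have vs_th k : th k \in vs by apply: Zvs; rewrite inE map_f ?orbT // mem_enum.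
have sG f v : G f -> v \in vs -> f v \in vs by move=> Gf; apply: vsG; apply: (ag_gal aG).
have [I [h [hG hex huniq]]] := agree_classes_finite sG.
have exh i : exists mu : {rmorphism algC -> algC}, (mu : algC -> algC) = h i.
  by apply: galQ_rmorph; apply: (ag_gal aG).
have [hn hnE] := boolp.choice exh.
pose J : finType := (I * bool)%type.
have exm (p : J) : exists mu : {rmorphism algC -> algC},
    (mu : algC -> algC) = if p.2 then nu \o h p.1 else h p.1.
  apply: galQ_rmorph; case: p => i [] /=; last exact: (ag_gal aG).
  by apply: galQ_comp; [apply: rmorph_galQ | apply: (ag_gal aG)].
have [emb embE] := boolp.choice exm.
have [i0 _] := hex id (ag_id aG).
have [n en] : exists n, #|J| = n.+1.
  by exists #|J|.-1; rewrite prednK //; apply/card_gt0P; exists (i0, false).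
pose idx (k : 'I_n.+1) : J := enum_val (cast_ord (esym en) k).
have idxI : injective idx by move=> k l /enum_val_inj/cast_ord_inj.
have distinct k l : k != l ->
    exists2 w, w \in rcons vs d & emb (idx k) w != emb (idx l) w.
  move=> ne; have {ne} : idx k != idx l by rewrite inj_eq.
  rewrite !embE; case: (idx k) => i b; case: (idx l) => j b' /=.
  have hd i' : h i' d = d by apply: Fd.
  have ex_vs : i != j -> exists2 w, w \in vs & h i w != h j w.
    move=> nij; apply: boolp.contrapT => nex; case/eqP: nij; apply: huniq => v hv.
    by apply: boolp.contrapT => /eqP nv; apply: nex; exists v.
  have [eb|nb] := eqVneq b b'.
    rewrite -eb => ne; have /ex_vs[w hw nw] : i != j.
      by apply: contraNneq ne => ->; rewrite eqxx.
    exists w; first by rewrite mem_rcons inE hw orbT.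
    by case: b {eb ne} => //=; rewrite (inj_eq (fmorph_inj nu)).
  move=> _; exists d; first by rewrite mem_rcons mem_head.
  by case: b b' nb => [] [] //= _; rewrite !hd ?(eq_sym d); apply/eqP.
have [c hc] := separating_comb (nu := fun k => emb (idx k)) distinct.
set w0 := \sum_(k < _) _ in hc.
have Fd' : fix_stab G vs d by move=> f Gf _; apply: Fd.
have Fw x : x \in rcons vs d -> fix_stab G vs x.
  by rewrite mem_rcons inE => /orP[/eqP -> //|hv]; apply: fix_stab_in.
have Fw0 : fix_stab G vs w0.
  apply: fix_stab_sum => // k _; apply: fix_stabM => //; first by apply: Fw; apply: mem_nth.
  by apply: fix_stabX => //; apply: fix_stab_nat.
have Aw0 : w0 \in Aint.
  apply: rpred_sum => k _; apply: rpredM; last by rewrite rpredX // rpred_nat.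
  have := mem_nth 0 (ltn_ord k); rewrite mem_rcons inE => /orP[/eqP -> //|]; exact: vsA.
have [Q oQ hQ] := nontorsion_trace_point intA intB cG tG vsG (fun k => (idx k).2) hth
  (fun k => fix_stab_in (vs_th k)) (fix_stab_in vs_eta) etaA eta2 eta0 Fw0 Aw0 hc.
exists (\sum_i pt_map (hn i) Q), nu; split=> //.
  apply: (trace_fixed intA intB cG _ _ _ oQ).
  - by move=> i; rewrite hnE.
  - by move=> f Gf; have [i a] := hex f Gf; exists i; rewrite hnE.
  - by move=> i j; rewrite !hnE; apply: huniq.
move=> m m0; have := hQ m m0; congr (is_true (_ *+ m != 0)).
pose H (p : J) := if p.2 then - pt_map (emb p) Q else pt_map (emb p) Q.
have -> : \sum_(k < n.+1) (if (idx k).2 then - pt_map (emb (idx k)) Q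
      else pt_map (emb (idx k)) Q) = \sum_p H p.
  rewrite (reindex idx) //=; exists (fun p => cast_ord en (enum_rank p)) => k _; rewrite /idx.
    by rewrite enum_valK cast_ordKV.
  by rewrite cast_ordK enum_rankK.
rewrite pt_map_sum; [|exact: rmorph_cA | exact: rmorph_cB].
rewrite -sumrB (eq_bigr (fun p : J => H (p.1, p.2))); last by case.
rewrite -(pair_bigA _ (fun i b => H (i, b))) /=; apply: eq_bigr => i _.
rewrite (bigD1 false) //= (bigD1 true) //= big1 ?addr0; last by case.
rewrite /H /=; congr (_ - _); apply: val_inj; rewrite /= !pval_pt_map // embE /= ?hnE //.
by case: (pval Q) => [[x y]|] //=; rewrite hnE.
Qed.

Definition lincomb (Ps : seq (point E)) (cs : seq int) : point E :=
  foldr +%R 0 [seq PC.1 *~ PC.2 | PC <- zip Ps cs].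

Definition coords (P : point E) : seq algC := if pval P is Some (x, y) then [:: x; y] else [::].

Lemma pt_map_coords (nu : {rmorphism algC -> algC}) P :
  (forall z, z \in coords P -> nu z = z) -> pt_map nu P = P.
Proof.
move=> h; apply: val_inj; rewrite /= pval_pt_map //; move: h; rewrite /coords.
by case: (pval P) => [[x y]|] //= h; rewrite !h // !inE eqxx ?orbT.
Qed.

(** As [nu] fixes the earlier points, subtracting from a relation its image under [nu] leaves c (T -
    nu T) = 0, whence c = 0. *)
Lemma indep_points n : exists Ps : seq (point E),
  [/\ size Ps = n, forall P, P \in Ps -> coords_in (fixed_field G) P &
   forall cs : seq int, size cs = n -> lincomb Ps cs = 0 -> forall c, c \in cs -> c = 0].
Proof.
elim: n => [|n [Ps [sP oP iP]]].
  by exists [::]; split=> // -[].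
have [T [nu [oT nuZ hT]]] := new_point (flatten [seq coords P | P <- Ps]).
exists (T :: Ps); split; first by rewrite /= sP.
  by move=> P; rewrite inE => /orP[/eqP ->|/oP].
case=> [//|c cs] [scs] e.
have fixl : pt_map nu (lincomb Ps cs) = lincomb Ps cs.
  have fixP P : P \in Ps -> pt_map nu P = P.
    move=> hP; apply: pt_map_coords => z hz; apply: nuZ; apply/flatten_mapP; by exists P.
  elim: (Ps) cs fixP {e scs sP oP iP nuZ} => [|P l IH] [|c' cs'] fixP;
    rewrite /lincomb /= ?(pt_map0 (rmorph_cA intA nu) (rmorph_cB intB nu)) //.
  rewrite (pt_mapD (rmorph_cA intA nu) (rmorph_cB intB nu)).
  rewrite (pt_mapMz (rmorph_cA intA nu) (rmorph_cB intB nu)) fixP ?mem_head //; congr (_ + _).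
  by apply: IH => P' hP'; apply: fixP; rewrite inE hP' orbT.
rewrite /lincomb /= -/(lincomb Ps cs) in e.
have e2 : pt_map nu T *~ c + lincomb Ps cs = 0.
  have := congr1 (pt_map nu) e.
  rewrite (pt_mapD (rmorph_cA intA nu) (rmorph_cB intB nu)).
  by rewrite (pt_mapMz (rmorph_cA intA nu) (rmorph_cB intB nu)) fixl (pt_map0 (rmorph_cA intA nu) (rmorph_cB intB nu)).
have e3 : (T - pt_map nu T) *~ c = 0.
  rewrite mulrzBl; apply/eqP; rewrite subr_eq0; apply/eqP.
  by apply: (addIr (lincomb Ps cs)); rewrite e e2.
have c0 : c = 0.
  case: c e3 {e e2} => [[|k]|k] // e3.
    by have := hT k.+1 isT; rewrite [_ *+ _]e3 eqxx.
  have := hT k.+1 isT; move/eqP: e3; rewrite NegzE mulrNz oppr_eq0 => /eqP e3.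
  by rewrite [_ *+ _]e3 eqxx.
rewrite c0 mulr0z add0r in e.
by move=> c'; rewrite inE => /orP[/eqP ->|]; [rewrite c0 | apply: iP].
Qed.

End MainStep.

(** * From short models to general Weierstrass equations *)

Section ShortModel.
Variable E : weq rat.
Local Notation A1 := (ratr (Defs.a1 E) : algC).
Local Notation A2 := (ratr (Defs.a2 E) : algC).
Local Notation A3 := (ratr (Defs.a3 E) : algC).
Local Notation A4 := (ratr (Defs.a4 E) : algC).
Local Notation A6 := (ratr (Defs.a6 E) : algC).
Variables (c : algC) (S : curve algC).
Hypothesis c0 : c != 0.
Local Notation b2 := (A1 ^+ 2 + 4%:R * A2).
Local Notation b4 := (2%:R * A4 + A1 * A3).
Local Notation b6 := (A3 ^+ 2 + 4%:R * A6).
Hypothesis hA : cA S = - c ^+ 4 * (b2 ^+ 2 - 24%:R * b4) / 48%:R.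
Hypothesis hB : cB S = c ^+ 6 * (b2 ^+ 3 - 36%:R * b2 * b4 + 216%:R * b6) / 864%:R.

(** Undoes the scaling by [c] and the completion of the square and the cube. In terms of the usual
    invariants, [cA S] is - c^4 c_4 / 48 and [cB S] is - c^6 c_6 / 864. *)
Definition from_short (P : option (algC * algC)) : option (algC * algC) :=
  if P is Some (X, Y) then
    let x := X / c ^+ 2 - b2 / 12%:R in Some (x, Y / c ^+ 3 - (A1 * x + A3) / 2%:R)
  else None.

Lemma from_short_on P : on_ec S P -> on_curve E (from_short P).
Proof.
case: P => [[X Y]|] //= /eqP h; apply/eqP; apply/eqP; rewrite -subr_eq0; apply/eqP.
transitivity ((Y ^+ 2 - (X ^+ 3 + cA S * X + cB S)) / c ^+ 6); last by rewrite h subrr mul0r.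
by rewrite hA hB; field; rewrite c0.
Qed.

Lemma from_short_opp P : pt_neg E (from_short P) = from_short (opp_ec P).
Proof.
by case: P => [[X Y]|] //=; congr (Some (_, _)); field; rewrite c0.
Qed.

Lemma from_short_add P Q : on_ec S P -> on_ec S Q ->
  pt_add E (from_short P) (from_short Q) = from_short (add_ec S P Q).
Proof.
case: P => [[X1 Y1]|] //; case: Q => [[X2 Y2]|] // oP oQ.
rewrite /from_short /pt_add /add_ec.
have eX : (X1 / c ^+ 2 - b2 / 12%:R == X2 / c ^+ 2 - b2 / 12%:R) = (X1 == X2).
  by rewrite (inj_eq (addIr _)) (inj_eq (mulIf _)) // invr_eq0 expf_neq0.
rewrite eX; case: (eqVneq X1 X2) => [e|ne] /=.
  subst X2.
  have -> : (Y1 / c ^+ 3 - (A1 * (X1 / c ^+ 2 - b2 / 12%:R) + A3) / 2%:R +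
     (Y2 / c ^+ 3 - (A1 * (X1 / c ^+ 2 - b2 / 12%:R) + A3) / 2%:R) +
     A1 * (X1 / c ^+ 2 - b2 / 12%:R) + A3 == 0) = (Y1 + Y2 == 0).
    have -> : Y1 / c ^+ 3 - (A1 * (X1 / c ^+ 2 - b2 / 12%:R) + A3) / 2%:R +
     (Y2 / c ^+ 3 - (A1 * (X1 / c ^+ 2 - b2 / 12%:R) + A3) / 2%:R) +
     A1 * (X1 / c ^+ 2 - b2 / 12%:R) + A3 = (Y1 + Y2) / c ^+ 3 by field; rewrite c0.
    by rewrite mulf_eq0 invr_eq0 expf_eq0 (negbTE c0) orbF.
  case: ifP => // nY; have eY := on_ec_eqx oP oQ nY; subst Y2.
  have Y0 : Y1 != 0 by apply/negP => /eqP z; rewrite z addr0 eqxx in nY.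
  have -> : 2%:R * (Y1 / c ^+ 3 - (A1 * (X1 / c ^+ 2 - b2 / 12%:R) + A3) / 2%:R) +
     A1 * (X1 / c ^+ 2 - b2 / 12%:R) + A3 = 2%:R * Y1 / c ^+ 3 by field; rewrite c0.
  by rewrite /third /=; congr (Some (_, _)); rewrite hA; field; rewrite c0 Y0.
rewrite /third; have d0 : X2 - X1 != 0 by rewrite subr_eq0 eq_sym.
have -> : X2 / c ^+ 2 - b2 / 12%:R - (X1 / c ^+ 2 - b2 / 12%:R) = (X2 - X1) / c ^+ 2 by ring.
set l := (X in X ^+ 2 + A1 * X).
have -> : l = (Y2 - Y1) / (X2 - X1) / c - A1 / 2%:R by rewrite /l; field; rewrite c0 d0.
by congr (Some (_, _)); field; rewrite c0 d0.
Qed.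

Lemma from_short_natmul (P : point S) n :
  pt_natmul E (from_short (pval P)) n = from_short (pval (P *+ n)).
Proof.
elim: n => [|n IH] //=; rewrite IH mulrS pvalD from_short_add //; exact: valP.
Qed.

Lemma from_short_intmul (P : point S) z :
  pt_intmul E (from_short (pval P)) z = from_short (pval (P *~ z)).
Proof.
case: z => n; first exact: from_short_natmul.
by rewrite /pt_intmul from_short_natmul from_short_opp.
Qed.

Lemma from_short_lincomb (Ps : seq (point S)) cs :
  pt_lincomb E [seq from_short (pval P) | P <- Ps] cs = from_short (pval (lincomb Ps cs)).
Proof.
rewrite /pt_lincomb /lincomb; elim: Ps cs => [|P Ps IH] [|z cs] //=.
by rewrite IH from_short_intmul from_short_add //; apply: valP.
Qed.

Lemma from_short_in (G : (algC -> algC) -> Prop) (P : point S) : autgroup G ->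
  c \in Crat -> coords_in (fixed_field G) P -> pt_in E (fixed_field G) (from_short (pval P)).
Proof.
move=> aG cQ; rewrite /coords_in /pt_in => oP; split; first exact: from_short_on (valP P).
move: oP; case: (pval P) => [[X Y]|] //= [hX hY].
have fx (q : rat) : fixed_field G (ratr q).
  by apply/fix_stab_nil; apply: fix_stab_rat => //; apply/CratP; exists q.
split=> f Gf; have [nu enu] := galQ_rmorph (ag_gal aG Gf);
  have := hX f Gf; have := hY f Gf; rewrite -enu => eY eX;
  have ec : nu c = c by apply: aut_Crat.
  by rewrite !(rmorphXn, fmorphV, rmorph_nat, fmorph_rat, rmorphD, rmorphN, rmorphM) ec eX.
by rewrite !(rmorphXn, fmorphV, rmorph_nat, fmorph_rat, rmorphD, rmorphN, rmorphM) ec eX eY.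
Qed.

End ShortModel.

Lemma rat_clear_denom (q : rat) (k m : nat) : (0 < k)%N ->
  (m * `|denq q|)%:R ^+ k * q \in Num.int.
Proof.
move=> k0; rewrite -(prednK k0) exprSr natrM -!mulrA.
have -> : (`|denq q|%N)%:R * q = (numq q)%:~R.
  by rewrite numqE mulrC; congr (_ * _); rewrite -[in RHS](gez0_abs (denq_ge0 q)).
apply: rpredM; first by rewrite rpredX // -natrM rpred_nat.
by apply: rpredM; [apply: rpred_nat | apply: rpred_int].
Qed.

Lemma ratr_disc (x y : rat) :
  ratr (- 16%:R * (4%:R * x ^+ 3 + 27%:R * y ^+ 2)) =
  - 16%:R * (4%:R * ratr x ^+ 3 + 27%:R * ratr y ^+ 2) :> algC.
Proof.
by rewrite !(rmorphXn, rmorph_nat, rmorphN, rmorphD, rmorphM).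
Qed.

Lemma ratr_short_a (k b2 b4 : rat) :
  ratr (k ^+ 4 * (- (b2 ^+ 2 - 24%:R * b4) / 48%:R)) =
  - ratr k ^+ 4 * (ratr b2 ^+ 2 - 24%:R * ratr b4) / 48%:R :> algC.
Proof.
rewrite rmorphM rmorphXn fmorph_div rmorphN rmorphB rmorphXn rmorphM !rmorph_nat.
by rewrite !mulNr mulrN mulrA.
Qed.

Lemma ratr_short_b (n1 n2 n3 : nat) (k b2 b4 b6 : rat) :
  ratr (k ^+ 6 * ((b2 ^+ 3 - n1%:R * b2 * b4 + n2%:R * b6) / n3%:R)) =
  ratr k ^+ 6 * (ratr b2 ^+ 3 - n1%:R * ratr b2 * ratr b4 + n2%:R * ratr b6) / n3%:R :> algC.
Proof.
rewrite rmorphM rmorphXn fmorph_div rmorphD rmorphB rmorphXn !rmorphM !rmorph_nat.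
by rewrite mulrA.
Qed.

Lemma ratr_b2 (x y : rat) : ratr (x ^+ 2 + 4%:R * y) = ratr x ^+ 2 + 4%:R * ratr y :> algC.
Proof. by rewrite rmorphD rmorphXn rmorphM rmorph_nat. Qed.

Lemma ratr_b4 (x y z : rat) :
  ratr (2%:R * x + y * z) = 2%:R * ratr x + ratr y * ratr z :> algC.
Proof. by rewrite rmorphD !rmorphM rmorph_nat. Qed.

Theorem theorem1p2 (E : weq rat) (G : (algC -> algC) -> Prop) :
  is_elliptic E -> analytic_rank_le1 E ->
  closed_subgroup G -> top_fin_gen G ->
  infinite_rank E (fixed_field G).
Proof.
move=> ellE _ cG tG n.
pose b2 := Defs.a1 E ^+ 2 + 4%:R * Defs.a2 E.
pose b4 := 2%:R * Defs.a4 E + Defs.a1 E * Defs.a3 E.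
pose b6 := Defs.a3 E ^+ 2 + 4%:R * Defs.a6 E.
pose qa : rat := - (b2 ^+ 2 - 24%:R * b4) / 48%:R.
pose qb : rat := (b2 ^+ 3 - 36%:R * b2 * b4 + 216%:R * b6) / 864%:R.
(* A common multiple of the denominators, so that scaling by [k] makes both coefficients of the
   short model integers. *)
pose k := (`|denq qb| * `|denq qa|)%N.
have k0 : (k%:R : rat) != 0 by rewrite pnatr_eq0 muln_eq0 !absz_eq0 !denq_eq0.
have Aint4 : k%:R ^+ 4 * qa \in Num.int by apply: rat_clear_denom.
have Bint6 : k%:R ^+ 6 * qb \in Num.int by rewrite /k mulnC; apply: rat_clear_denom.
have disc : - 16%:R * (4%:R * (k%:R ^+ 4 * qa) ^+ 3 + 27%:R * (k%:R ^+ 6 * qb) ^+ 2)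
    = k%:R ^+ 12 * wdisc E.
  by rewrite /qa /qb /wdisc -/b2 -/b4 -/b6 /b2 /b4 /b6; field.
have discC : - 16%:R * (4%:R * (ratr (k%:R ^+ 4 * qa)) ^+ 3 + 27%:R * (ratr (k%:R ^+ 6 * qb)) ^+ 2) != 0 :> algC.
  by rewrite -ratr_disc disc fmorph_eq0 mulf_neq0 ?expf_neq0.
pose S := Curve discC.
have ratrint q : q \in Num.int -> (ratr q : algC) \in Num.int.
  by move=> /intrP[z ->]; rewrite rmorph_int rpred_int.
have [Ps [sP oP iP]] := @indep_points S (ratrint _ Aint4) (ratrint _ Bint6) G cG tG n.
pose c : algC := k%:R.
have c0 : c != 0 by rewrite pnatr_eq0 -(pnatr_eq0 rat).
have hA : cA S = - c ^+ 4 * ((ratr (Defs.a1 E) ^+ 2 + 4%:R * ratr (Defs.a2 E)) ^+ 2 -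
   24%:R * (2%:R * ratr (Defs.a4 E) + ratr (Defs.a1 E) * ratr (Defs.a3 E))) / 48%:R.
  by rewrite /S [LHS]/= ratr_short_a ratr_b2 ratr_b4 rmorph_nat.
have hB : cB S = c ^+ 6 * ((ratr (Defs.a1 E) ^+ 2 + 4%:R * ratr (Defs.a2 E)) ^+ 3 -
   36%:R * (ratr (Defs.a1 E) ^+ 2 + 4%:R * ratr (Defs.a2 E)) *
     (2%:R * ratr (Defs.a4 E) + ratr (Defs.a1 E) * ratr (Defs.a3 E)) +
   216%:R * (ratr (Defs.a3 E) ^+ 2 + 4%:R * ratr (Defs.a6 E))) / 864%:R.
  by rewrite /S [LHS]/= ratr_short_b !ratr_b2 ratr_b4 rmorph_nat.
exists [seq from_short E c (pval P) | P <- Ps]; split; first by rewrite size_map.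
split.
  move=> _ /mapP[P hP ->]; apply: (from_short_in c0 hA hB) => //.
  - exact: closed_autgroup.
  - exact: rpred_nat.
  - exact: oP.
move=> cs scs; rewrite (from_short_lincomb c0 hA) => e; apply: iP => //.
by apply: val_inj; move: e; rewrite /=; case: (pval _) => [[]|].
Qed.
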